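(* The set of matrices with rational entries in $\partial\mathcal{CP}_5 \cap\mathcal{DNN}_5^\circ$ is dense in $\partial\mathcal{CP}_5 \cap\mathcal{DNN}_5^\circ$ with respect to the Euclidean topology, that is, $\partial\mathcal{CP}_5 \cap\mathcal{DNN}_5^\circ \subseteq \overline{\partial\mathcal{CP}_5 \cap\mathcal{DNN}_5^\circ \cap Sym_5(\mathbb{Q})}$.
   Context: $Sym_5$ is the space of real symmetric $5\times 5$ matrices and $Sym_5(\mathbb{Q})$ its subset of matrices with rational entries. $\mathcal{CP}_5$ is the cone of matrices $BB^{\mathsf T}$ with $B$ a real $5\times k$ matrix with nonnegative entries (some $k$); $\mathcal{DNN}_5$ is the cone of positive semidefinite $5\times 5$ matrices with nonnegative entries; $\partial$, ${}^\circ$ and the overline denote boundary, interior and closure in the Euclidean topology of $Sym_5$. *)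

(* Defs.v *)
From HB Require Import structures.
From mathcomp Require Import all_boot all_order all_algebra.
From mathcomp Require Import reals.
Set Implicit Arguments. Unset Strict Implicit. Unset Printing Implicit Defensive.
Import Order.TTheory GRing.Theory Num.Theory.
Local Open Scope ring_scope.

Section Cones.
Variable R : realType.

Definition is_sym n (A : 'M[R]_n) : Prop := A^T = A.

Definition rational_mx n (A : 'M[R]_n) : Prop :=
  exists Q : 'M[rat]_n, A = map_mx (fun q : rat => ratr q) Q.

Definition CP n (A : 'M[R]_n) : Prop :=
  exists k : nat, exists B : 'M[R]_(n, k),
    (forall i j, 0 <= B i j) /\ A = B *m B^T.

Definition psd n (A : 'M[R]_n) : Prop :=
  is_sym A /\ forall x : 'cV[R]_n, 0 <= (x^T *m A *m x) 0 0.

Definition DNN n (A : 'M[R]_n) : Prop :=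
  psd A /\ forall i j, 0 <= A i j.

(* Euclidean topology of Sym_n, via the (equivalent) max-entry metric:
   B lies in the open ball of radius e around A. *)
Definition near_mx n (A B : 'M[R]_n) (e : R) : Prop :=
  forall i j, `|A i j - B i j| < e.

Definition sym_interior n (S : 'M[R]_n -> Prop) (A : 'M[R]_n) : Prop :=
  is_sym A /\ exists e : R, 0 < e /\
    forall B : 'M[R]_n, is_sym B -> near_mx A B e -> S B.

Definition sym_closure n (S : 'M[R]_n -> Prop) (A : 'M[R]_n) : Prop :=
  is_sym A /\ forall e : R, 0 < e ->
    exists B : 'M[R]_n, is_sym B /\ near_mx A B e /\ S B.

Definition sym_boundary n (S : 'M[R]_n -> Prop) (A : 'M[R]_n) : Prop :=
  sym_closure S A /\ sym_closure (fun B => ~ S B) A.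

End Cones.

(* Main.v *)
Require Import Defs.
From HB Require Import structures.
From mathcomp Require Import all_boot all_order all_algebra.
From mathcomp Require Import reals.
From mathcomp Require Import all_fingroup boolp classical_sets topology.
From mathcomp Require Import normedtype sequences derive.
From mathcomp Require Import ring lra zify.
Set Implicit Arguments. Unset Strict Implicit. Unset Printing Implicit Defensive.

(** Let [A] lie on the boundary of the completely positive cone and in the
    interior of the doubly nonnegative one. A copositive form [c] supports the
    cone at [A], and [A = sum b b^T] with all [b] zeros of [c]. Since [A] is
    positive definite and entrywise positive, the zeros of [c] span the space
    and every pair of indices lies in the support of one of them. If [c] were
    semidefinite on a coordinate hyperplane it would be the sum of a
    semidefinite and a nonnegative form, hence zero; so no zero has more than
    three positive entries. A finite search over the possible families of
    minimal supports then shows that, up to scaling and relabelling, [c] is the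
    Horn form or one of Hildebrand's forms T(theta), and its zeros are known
    explicitly. Both families are rationally parametrized (points of the unit
    circle for the cosines and sines of theta), so the data of the
    decomposition can be moved to rational ones, the moved vectors being again
    zeros of a common copositive form, which keeps the matrix on the boundary. *)

(** * Families of minimal supports *)

(** The obstacle is that the supporting form may be irrational: rational approximations of the
    columns [b] are then no longer zeros of it, and the matrix may leave the boundary. Form and
    vectors must move together. This works because the zeros are explicit: the equations they
    satisfy only use cos^2 + sin^2 = 1, so they hold at every rational point of the circle, while
    the other conditions for copositivity are strict inequalities, stable under small changes. The
    interior of the doubly nonnegative cone is open and takes care of itself.

    The search is finite because, once the diagonal is scaled to 1, every zero is a combination of
    two kinds of generators: sums of two basis vectors, at entries -1, and zeros with three positive
    entries, which their support determines up to a factor. There are 20 supports of size two or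
    three, and spanning forces at least five of them to occur. *)

(* Backtracking over the [k]-element subsequences of [s]: [pats] holds what
   remains to be found of each pattern, a branch being closed when some pattern
   is exhausted or when its final selection is [good]. *)
Fixpoint search (T : eqType) (good : pred (seq T)) (pats : seq (seq T))
    (acc : seq T) (k : nat) (s : seq T) {struct s} : bool :=
  if has (@nilp T) pats then true else
  match k, s with
  | 0, _ => good acc
  | _, [::] => true
  | k'.+1, x :: s' =>
      if @search T good [seq rem x P | P <- pats] (x :: acc) k' s'
      then @search T good [seq P <- pats | x \notin P] acc k s' else false
  end.

(** Discarding the patterns that contain a skipped element is sound, as it only makes branches
    harder to close. The selection appears as [catrev t acc] because it is accumulated in
    reverse. *)
Lemma searchP (T : eqType) (good : pred (seq T)) pats acc k s t :
  search good pats acc k s -> subseq t s -> size t = k ->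
  has (all (mem t)) pats \/ good (catrev t acc).
Proof.
have nil_ok pts u : has (@nilp T) pts -> has (all (mem u)) pts.
  by apply: sub_has => P /nilP ->.
elim: s k t pats acc => [|x s IH] [|k] [|y t] pats acc //=;
  case: ifP => [/nil_ok h _ _ _|_]; try by left.
- by right.
- by right.
case: ifP => // sx s' + [st].
case: eqP => [->|_] ts.
  have [|h] := IH k t _ _ sx ts st; last by right.
  rewrite has_map => /hasP[P Pp /allP h]; left; apply/hasP; exists P => //.
  apply/allP => z zP; rewrite /= inE; case: eqVneq => //= zx.
  by apply: h; rewrite rem_mem.
have [|h] := IH k.+1 (y :: t) _ _ s' ts (congr1 S st); last by right.
by move=> /hasP[P]; rewrite mem_filter => /andP[_ Pp] h; left; apply/hasP; exists P.
Qed.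

Definition edge i j : seq nat := sort leq [:: i; j].
Definition triple i j k : seq nat := sort leq [:: i; j; k].

(** An edge records an entry -1, a triple a zero with three positive entries and no -1 among them.
    The patterns are refuted, in this order, by [no_triangle], [no_claw], [no_four_cycle],
    [no_tight_edge], [no_tight_path], [no_tight_pair_edge], [no_three_tight] and [no_tight_star]. *)
Definition bad_patterns (p : seq nat) : seq (seq (seq nat)) :=
  if p is [:: i; j; k; l; m] then
   [:: [:: edge i j; edge j k; edge i k];
       [:: edge i j; edge i k; edge i l];
       [:: edge i j; edge j k; edge k l; edge l i];
       [:: triple i j k; edge i j];
       [:: triple i k l; edge i j; edge j k];
       [:: triple i j k; triple i j l; edge k l];
       [:: triple i j k; triple i j l; triple i k l];
       [:: triple i j k; triple i j l; triple i j m]]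
  else [::].

(** The pentagon of edges is the Horn case, the cycle of triples the Hildebrand case. *)
Definition cyclic_patterns (p : seq nat) : seq (seq (seq nat)) :=
  if p is [:: i; j; k; l; m] then
    [:: [:: edge i j; edge j k; edge k l; edge l m; edge m i];
        [:: triple i j k; triple j k l; triple k l m; triple l m i; triple m i j]]
  else [::].

(** Supports are sorted by their bit masks, so that relabellings listing the same family in
    different orders coincide and [undup] removes the copies. *)
Definition all_patterns (f : seq nat -> seq (seq (seq nat))) : seq (seq (seq nat)) :=
  undup [seq sort (fun s t : seq nat => foldl (fun n i => n + 2 ^ i) 0 s
                 <= foldl (fun n i => n + 2 ^ i) 0 t) P
        | P <- flatten [seq f p | p <- permutations (iota 0 5)]].

Definition small_supports : seq (seq nat) :=
  [:: edge 0 1; edge 0 2; edge 0 3; edge 0 4; edge 1 2;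
      edge 1 3; edge 1 4; edge 2 3; edge 2 4; edge 3 4;
      triple 0 1 2; triple 0 1 3; triple 0 1 4; triple 0 2 3; triple 0 2 4;
      triple 0 3 4; triple 1 2 3; triple 1 2 4; triple 1 3 4; triple 2 3 4].

Lemma search_small_supports :
  search (fun L => has (all (mem L)) (all_patterns cyclic_patterns))
    (all_patterns bad_patterns) [::] 5 small_supports.
Proof. by vm_compute. Qed.

Import Order.TTheory GRing.Theory Num.Theory.
Local Open Scope ring_scope.

(** * Zeros of copositive forms *)

Section Forms.
Variables (R : realFieldType) (n : nat).
Implicit Types (c : 'I_n -> 'I_n -> R) (x u v w : 'I_n -> R).

Definition lin c u i := \sum_j c i j * u j.
Definition bil c x u := \sum_i x i * lin c u i.
Definition qf c x := bil c x x.
Definition copos c := forall x, (forall i, 0 <= x i) -> 0 <= qf c x.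
Definition zero_of c u := (forall i, 0 <= u i) /\ qf c u = 0.
Definition symf c := forall i j, c i j = c j i.
Definition dl (i : 'I_n) : 'I_n -> R := fun j => (j == i)%:R.

Lemma sum_dl i (F : 'I_n -> R) : \sum_j dl i j * F j = F i.
Proof.
rewrite (bigD1 i) //= /dl eqxx mul1r big1 ?addr0 // => j /negPf->.
by rewrite mul0r.
Qed.

Lemma bil_dl c u i : bil c (dl i) u = lin c u i.
Proof. exact: sum_dl. Qed.

Lemma lin_dl c i j : lin c (dl j) i = c i j.
Proof.
rewrite /lin; under eq_bigr do rewrite mulrC.
exact: sum_dl.
Qed.

Lemma lin_comb c x u t i :
  lin c (fun j => x j + t * u j) i = lin c x i + t * lin c u i.
Proof.
rewrite /lin mulr_sumr -big_split; apply: eq_bigr => j _ /=; ring.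
Qed.

Lemma bil_combl c x y u t :
  bil c (fun j => x j + t * y j) u = bil c x u + t * bil c y u.
Proof.
rewrite /bil mulr_sumr -big_split; apply: eq_bigr => j _ /=; ring.
Qed.

Lemma bil_combr c x u y t :
  bil c x (fun j => u j + t * y j) = bil c x u + t * bil c x y.
Proof.
rewrite /bil mulr_sumr -big_split; apply: eq_bigr => j _ /=.
by rewrite lin_comb; ring.
Qed.

Lemma bilC c x u : symf c -> bil c x u = bil c u x.
Proof.
move=> sc; rewrite /bil /lin.
under eq_bigr do rewrite mulr_sumr.
rewrite exchange_big /=; apply: eq_bigr => j _; rewrite mulr_sumr.
by apply: eq_bigr => i _; rewrite sc; ring.
Qed.

Lemma qf_comb c x u t : symf c ->
  qf c (fun j => x j + t * u j) = qf c x + 2 * t * bil c x u + t ^+ 2 * qf c u.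
Proof.
move=> sc; rewrite /qf bil_combl !bil_combr (bilC u x sc); ring.
Qed.

Lemma eq_lin c u v i : u =1 v -> lin c u i = lin c v i.
Proof. by move=> e; apply: eq_bigr => j _; rewrite e. Qed.

Lemma eq_qf c u v : u =1 v -> qf c u = qf c v.
Proof. by move=> e; apply: eq_bigr => j _; rewrite e (eq_lin _ _ e). Qed.

(** This is the first-order condition at a one-sided minimum. The range stops at 1 for the sake of
    [CP_separation], where [(1 - t) *: P] has to remain in the cone. *)
Lemma quad_pos_ge0 (a l : R) :
  (forall t, 0 < t -> t <= 1 -> 0 <= 2 * t * l + t ^+ 2 * a) -> 0 <= l.
Proof.
move=> h; case: leP => // lt0; exfalso.
have d0 : 0 < `|a| + 1 - l by have := normr_ge0 a; lra.
(* This [t] lies in (0, 1] and gives [t * a <= - l], hence [2 * l + t * a <= l < 0]. *)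
pose t := - l / (`|a| + 1 - l).
have t0 : 0 < t by rewrite divr_gt0 // oppr_gt0.
have t1 : t <= 1 by rewrite ler_pdivrMr //; have := normr_ge0 a; lra.
have := h t t0 t1.
have -> : 2 * t * l + t ^+ 2 * a = t * (2 * l + t * a) by ring.
rewrite pmulr_rge0 //.
have : t * a <= t * (`|a| + 1 - l).
  by rewrite ler_pM2l //; have := ler_norm a; lra.
have -> : t * (`|a| + 1 - l) = - l by rewrite /t divfK ?gt_eqF.
by move: lt0; lra.
Qed.

Section Zeros.
Variable c : 'I_n -> 'I_n -> R.
Hypotheses (sc : symf c) (cc : copos c).

(** A zero minimizes the form over the orthant, so its derivative in each coordinate direction is
    nonnegative; [zero_lin_eq0] is the complementary slackness. *)
Lemma zero_lin_ge0 u i : zero_of c u -> 0 <= lin c u i.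
Proof.
move=> [u0 qu0]; apply: (@quad_pos_ge0 (c i i)) => t t0 _.
have : 0 <= qf c (fun j => u j + t * dl i j).
  by apply: cc => j; rewrite /dl addr_ge0 // mulr_ge0 ?ler0n // ltW.
by rewrite qf_comb // qu0 bilC // bil_dl /qf bil_dl lin_dl add0r.
Qed.

Lemma zero_lin_eq0 u i : zero_of c u -> 0 < u i -> lin c u i = 0.
Proof.
move=> zu ui; case: (zu) => u0 qu0.
have : forall j, true -> u j * lin c u j = 0.
  have := qu0; rewrite /qf /bil => /psumr_eq0P; apply => j _.
  by rewrite mulr_ge0 // zero_lin_ge0.
by move=> /(_ i isT) /eqP; rewrite mulf_eq0 gt_eqF //= => /eqP.
Qed.

Lemma zero_bil_ge0 u x : zero_of c u -> (forall i, 0 <= x i) -> 0 <= bil c x u.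
Proof. by move=> zu x0; apply: sumr_ge0 => i _; rewrite mulr_ge0 ?zero_lin_ge0. Qed.

(* Adding a large multiple of [u] makes [x] nonnegative without changing the
   value of the form. *)
Lemma qf_zero_ge0 u x : zero_of c u -> (forall i, u i = 0 -> 0 <= x i) ->
  (forall i, x i * lin c u i = 0) -> 0 <= qf c x.
Proof.
move=> zu xp xl; case: (zu) => u0 qu0.
(* Indices with [u j = 0] contribute 0, as the inverse of 0 is 0. *)
pose M := \sum_j `|x j| / u j.
have -> : qf c x = qf c (fun j => x j + M * u j).
  by rewrite qf_comb // qu0 /bil big1; [ring|move=> i _; exact: xl].
apply: cc => j; have [uj0|uj] := eqVneq (u j) 0.
  by rewrite uj0 mulr0 addr0 xp.
have uj0 : 0 < u j by rewrite lt_def uj u0.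
have : `|x j| / u j <= M.
  rewrite /M (bigD1 j) //= lerDl sumr_ge0 // => i _.
  by rewrite divr_ge0.
rewrite ler_pdivrMr // => le; have := ler_norm (- x j); rewrite normrN; lra.
Qed.

Lemma qf_supp_ge0 u x : zero_of c u -> (forall i, u i = 0 -> x i = 0) ->
  0 <= qf c x.
Proof.
move=> zu xu; apply: (qf_zero_ge0 zu) => i; first by move/xu->.
have [/xu->|ui] := eqVneq (u i) 0; first by rewrite mul0r.
by rewrite zero_lin_eq0 ?mulr0 // lt_def ui zu.1.
Qed.

(** The value at [w - t u] is [- 2 t] times [bil c w u], so this bilinear value is at most 0. It is
    also a sum of nonnegative terms, which therefore all vanish. *)
Lemma zero_peel u w t i : zero_of c u -> zero_of c w -> 0 < t ->
  0 <= qf c (fun j => w j - t * u j) -> w i * lin c u i = 0.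
Proof.
move=> zu zw t0.
have -> : qf c (fun j => w j - t * u j) = qf c (fun j => w j + (- t) * u j).
  by apply: eq_qf => j; rewrite mulNr.
rewrite qf_comb // zu.2 zw.2 => le.
have b0 : bil c w u = 0.
  apply/eqP; rewrite eq_le zero_bil_ge0 ?andbT; [|by []|exact: zw.1].
  by rewrite -(pmulr_rle0 _ t0); lra.
move/psumr_eq0P: b0 => -> // j _.
by rewrite mulr_ge0 ?zero_lin_ge0 // zw.1.
Qed.

Lemma zero_add u v : zero_of c u -> zero_of c v -> bil c u v = 0 ->
  zero_of c (fun j => u j + 1 * v j).
Proof.
move=> zu zv b0; split=> [i|]; last by rewrite qf_comb // zu.2 zv.2 b0; ring.
by rewrite mul1r addr_ge0 ?zu.1 ?zv.1.
Qed.

End Zeros.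

(* [exposing_cover] and [exposing_span] reflect that a matrix exposed by [c] is
   entrywise positive, respectively positive definite. *)
Record exposing c : Prop := Exposing {
  exposing_sym : symf c;
  exposing_copos : copos c;
  exposing_neq0 : exists i j, c i j != 0;
  exposing_cover : forall i j, exists u, [/\ zero_of c u, 0 < u i & 0 < u j];
  exposing_span : forall x, (forall u, zero_of c u -> \sum_i x i * u i = 0) ->
    forall i, x i = 0 }.

Section Exposing.
Variable c : 'I_n -> 'I_n -> R.
Hypothesis ec : exposing c.
Let sc := exposing_sym ec.
Let cc := exposing_copos ec.

(** A zero of a semidefinite form lies in its kernel; each row of [c] would be orthogonal to all
    zeros, which span. *)
Lemma exposing_not_psd : ~ (forall x, 0 <= qf c x).
Proof.
move=> psdc; case: (exposing_neq0 ec) => i [j /eqP]; apply.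
have l0 u : zero_of c u -> lin c u i = 0.
  move=> zu; apply/le_anti; rewrite (zero_lin_ge0 sc cc) // andbT -oppr_ge0.
  apply: (@quad_pos_ge0 (c i i)) => t _ _.
  have := psdc (fun j => u j + (- t) * dl i j).
  rewrite qf_comb // zu.2 bilC // bil_dl /qf bil_dl lin_dl.
  by rewrite add0r sqrrN mulrN !mulNr mulrN.
exact: (exposing_span ec (x := c i)).
Qed.

(* For a zero [b] with [b m > 0], [qf c] is the sum of the semidefinite form
   [x |-> qf c (x - (x m / b m) b)] and of [2 (x m / b m) (c b . x)], whose
   coefficients are nonnegative; the covering property kills the second term. *)
Lemma exposing_not_psd_facet m :
  ~ (forall x, x m = 0 -> 0 <= qf c x).
Proof.
move=> psdm; have [b [zb bm _]] := exposing_cover ec m m.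
have bl i : lin c b i = 0.
  have [z [zz zm zi]] := exposing_cover ec m i.
  have /eqP : z i * lin c b i = 0.
    apply: (zero_peel sc cc i zb zz (divr_gt0 zm bm)); apply: psdm.
    by rewrite divfK ?subrr // gt_eqF.
  by rewrite mulf_eq0 gt_eqF //= => /eqP.
apply: exposing_not_psd => x.
have := psdm (fun j => x j + (- (x m / b m)) * b j).
rewrite qf_comb // zb.2 /bil big1 => [|i _]; last by rewrite bl mulr0.
rewrite !mulr0 !addr0; apply.
by rewrite mulNr divfK ?subrr // gt_eqF.
Qed.

Lemma exposing_zero_small u m : zero_of c u ->
  (forall i, i != m -> 0 < u i) -> False.
Proof.
move=> zu um; apply: (@exposing_not_psd_facet m) => x xm.
apply: (qf_supp_ge0 sc cc zu) => i ui.
by have [->//|/um] := eqVneq i m; rewrite ui ltxx.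
Qed.

(** If the value at [l] were 0, the condition of [qf_zero_ge0] on products would hold for all [x]
    with [x m = 0]. Its sign condition then concerns [x l] alone and is met by [x] or by [- x], so
    the form would be semidefinite on a facet. *)
Lemma exposing_lin_gt0 u l m : zero_of c u -> l != m ->
  (forall i, i != l -> i != m -> 0 < u i) -> 0 < lin c u l.
Proof.
move=> zu lm ui; rewrite lt_def (zero_lin_ge0 sc cc) // andbT.
apply/negP => /eqP ul0; apply: (@exposing_not_psd_facet m) => x xm.
have qN : qf c x = qf c (fun j => - x j).
  rewrite /qf /bil; apply: eq_bigr => i _; rewrite /lin mulNr -mulrN -sumrN.
  by congr (_ * _); apply: eq_bigr => j _; ring.
have xl y : y m = 0 -> forall i, y i * lin c u i = 0.
  move=> ym i; have [->|il] := eqVneq i l; first by rewrite ul0 mulr0.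
  have [->|im] := eqVneq i m; first by rewrite ym mul0r.
  by rewrite (zero_lin_eq0 sc cc) ?mulr0 ?ui.
have pos y : y m = 0 -> 0 <= y l -> 0 <= qf c y.
  move=> ym yl; apply: (qf_zero_ge0 sc cc zu) (xl y ym) => i u0.
  have [->//|il] := eqVneq i l; have [->|im] := eqVneq i m; first by rewrite ym.
  by have := ui i il im; rewrite u0 ltxx.
have [x0|x0] := leP 0 (x l); first exact: pos.
by rewrite qN; apply: pos; rewrite ?xm ?oppr0 // oppr_ge0 ltW.
Qed.

(** Peeling [u] off [w] until entry [k] vanishes leaves a vector supported where [v] is positive, so
    the form is nonnegative there. By [zero_peel], [lin c u l = 0], against [exposing_lin_gt0]. *)
Lemma exposing_no_third u v w k l m : zero_of c u -> zero_of c v ->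
  zero_of c w -> l != m ->
  (forall i, i != l -> i != m -> 0 < u i) -> u m = 0 ->
  k != l -> k != m -> (forall i, i != k -> i != m -> 0 < v i) ->
  w m = 0 -> 0 < w k -> 0 < w l -> False.
Proof.
move=> zu zv zw lm ui um kl km vi wm wk wl.
have uk := ui k kl km.
have /eqP : w l * lin c u l = 0.
  apply: (zero_peel sc cc l zu zw (divr_gt0 wk uk)).
  apply: (qf_supp_ge0 sc cc zv) => i v0.
  have [->|ik] := eqVneq i k; first by rewrite divfK ?subrr // gt_eqF.
  have [->|im] := eqVneq i m; first by rewrite wm um mulr0 subrr.
  by have := vi i ik im; rewrite v0 ltxx.
by rewrite mulf_eq0 !gt_eqF // (exposing_lin_gt0 zu lm).
Qed.

(* A zero covering [{k, l}] is supported on [{k, l, m}]; peeling [u], [v] and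
   [z] off it leaves a vector supported where [c] is semidefinite. *)
Lemma exposing_no_star u v z k l m : uniq [:: k; l; m] ->
  zero_of c u -> zero_of c v -> zero_of c z ->
  (forall i, (0 < u i) = (i != l) && (i != m)) ->
  (forall i, (0 < v i) = (i != k) && (i != m)) ->
  (forall i, (0 < z i) = (i != k) && (i != l)) ->
  (exists i j, [/\ i != j, i \notin [:: k; l; m], j \notin [:: k; l; m]
    & forall p, p \in [:: i; j; k; l; m]]) -> False.
Proof.
rewrite /= !inE negb_or => /and3P[/andP[kl km] lm _] zu zv zz up vp zp.
have nul (y : 'I_n -> R) i : zero_of c y -> (0 < y i) = false -> y i = 0.
  by move=> zy yi; apply: contraFeq yi => ni; rewrite lt_def ni zy.1.
move=> [i [j [ij + + all5]]].
rewrite !inE !negb_or => /and3P[ik il im] /and3P[jk jl jm].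
have [w [zw wk wl]] := exposing_cover ec k l.
have wm : 0 < w m.
  case: (boolP (0 < w m)) => // /negbTE /(nul w m zw) wm; exfalso.
  apply: (exposing_no_third (k := k) (l := l) (m := m) zu zv zw) => //.
  - by move=> p pl pm; rewrite up pl.
  - by rewrite nul // up eqxx andbF.
  - by move=> p pk pm; rewrite vp pk.
have wi a b : [:: i; j; k; l; m] =i [:: a; b; k; l; m] -> w a = 0.
  move=> e; case: (boolP (0 < w a)) => [wa|/negbTE/(nul w a zw)//].
  exfalso; apply: (exposing_zero_small (m := b) zw) => p.
  have := all5 p; rewrite e !inE => /or4P[/eqP->//|/eqP->|/eqP->//|].
    by rewrite eqxx.
  by case/orP => /eqP->.
have wi0 : w i = 0 by apply: (wi i j).
have wj0 : w j = 0 by apply: (wi j i) => p; rewrite !inE orbCA.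
have uk : 0 < u k by rewrite up kl km.
have vl : 0 < v l by rewrite vp eq_sym kl lm.
have zm : 0 < z m by rewrite zp !(eq_sym m) km lm.
have ul : u l = 0 by rewrite nul // up eqxx.
have um : u m = 0 by rewrite nul // up eqxx andbF.
have vk : v k = 0 by rewrite nul // vp eqxx.
have vm : v m = 0 by rewrite nul // vp eqxx andbF.
have zk : z k = 0 by rewrite nul // zp eqxx.
have zl : z l = 0 by rewrite nul // zp eqxx andbF.
have uij p : p \in [:: i; j] -> [/\ 0 < u p, 0 < v p & 0 < z p].
  by rewrite !inE up vp zp => /orP[] /eqP->; split; apply/andP.
pose t := w k / u k; pose t' := w l / v l; pose t'' := w m / z m.
(* The three subtractions kill the entries [k], [l], [m] in turn, so [y3] lives on [i], [j], where
   [u] is positive. Adding [z] back leaves the value unchanged, and adding [v] back does not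
   decrease it: the only cross term that survives is at [m], where [y2] equals [w]. *)
pose y1 p := w p - t * u p; pose y2 p := y1 p + (- t') * v p.
pose y3 p := y2 p + (- t'') * z p.
have y3k : y3 k = 0 by rewrite /y3 /y2 /y1 vk zk /t divfK ?gt_eqF //; ring.
have y3l : y3 l = 0 by rewrite /y3 /y2 /y1 ul zl !mulNr /t' divfK ?gt_eqF //; ring.
have y3m : y3 m = 0 by rewrite /y3 /y2 /y1 um vm !mulNr /t'' divfK ?gt_eqF //; ring.
have q3 : 0 <= qf c y3.
  apply: (qf_supp_ge0 sc cc zu) => p u0; have := all5 p.
  rewrite 2!inE orbA => /orP[pij|].
    by have [] := uij p; rewrite ?inE // u0 ltxx.
  by rewrite !inE => /or3P[] /eqP->.
have q2 : qf c y2 = qf c y3.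
  have -> : qf c y2 = qf c (fun p => y3 p + t'' * z p).
    by apply: eq_qf => p; rewrite /y3; ring.
  rewrite qf_comb // zz.2 /bil big1 => [|p _]; first by ring.
  have := all5 p; rewrite 2!inE orbA => /orP[pij|].
    have [|_ _ zp0] := uij p; first by rewrite !inE.
    by rewrite (zero_lin_eq0 sc cc zz) ?mulr0.
  by rewrite !inE => /or3P[] /eqP->; rewrite ?y3k ?y3l ?y3m mul0r.
have q1 : 0 <= qf c y1.
  have -> : qf c y1 = qf c (fun p => y2 p + t' * v p).
    by apply: eq_qf => p; rewrite /y2; ring.
  rewrite qf_comb // q2 zv.2 mulr0 addr0 addr_ge0 // mulr_ge0 //.
    by rewrite mulr_ge0 // divr_ge0 // ltW.
  apply: sumr_ge0 => p _.
  have := all5 p; rewrite 2!inE orbA => /orP[pij|].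
    have [|_ vp0 _] := uij p; first by rewrite !inE.
    by rewrite (zero_lin_eq0 sc cc zv) ?mulr0.
  rewrite !inE => /or3P[] /eqP->.
  - by rewrite /y2 /y1 vk /t divfK ?gt_eqF // subrr add0r mulr0 mul0r.
  - by rewrite (zero_lin_eq0 sc cc zv) ?mulr0.
  - by rewrite /y2 /y1 um vm !mulr0 subr0 addr0 mulr_ge0 ?(zero_lin_ge0 sc cc) // ltW.
have /eqP : w l * lin c u l = 0.
  exact: (zero_peel sc cc l zu zw (divr_gt0 wk uk)).
rewrite mulf_eq0 !gt_eqF //.
by apply: (exposing_lin_gt0 zu lm) => p pl pm; rewrite up pl.
Qed.

End Exposing.
End Forms.

(** * Five indices *)

Ltac uniq_by_perm us :=
  refine (etrans _ us : uniq _ = true); apply: perm_uniq;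
  apply/seq.permP; clear; move=> ? /=; lia.

Lemma mem_uniq5 (s : seq 'I_5) : uniq s -> size s = 5%N -> forall p, p \in s.
Proof.
move=> us ss p.
have [|_ ->] := uniq_min_size us (fun x _ => mem_enum 'I_5 x).
  by rewrite ss size_enum_ord.
exact: mem_enum.
Qed.

Lemma sum_uniq5 (V : nmodType) (F : 'I_5 -> V) i j k l m :
  uniq [:: i; j; k; l; m] -> \sum_p F p = F i + F j + F k + F l + F m.
Proof.
move=> u; rewrite -big_enum (perm_big [:: i; j; k; l; m]) /=.
  by rewrite !big_cons big_nil addr0 !addrA.
apply: uniq_perm; rewrite ?enum_uniq // => p.
by rewrite mem_enum mem_uniq5.
Qed.

Lemma uniq_complete3 (i j k : 'I_5) : uniq [:: i; j; k] ->
  exists l m, uniq [:: i; j; k; l; m].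
Proof.
move=> u; have : size [seq p <- enum 'I_5 | p \notin [:: i; j; k]] = 2%N.
  have := count_predC (mem [:: i; j; k]) (enum 'I_5).
  rewrite size_enum_ord size_filter.
  have -> : count (mem [:: i; j; k]) (enum 'I_5) = 3%N.
    rewrite -size_filter; apply: (perm_size (s2 := [:: i; j; k])).
    apply: uniq_perm => [||p]; [exact: filter_uniq (enum_uniq _)|by []|].
    by rewrite mem_filter mem_enum andbT.
  by rewrite -[5%N]/(3 + 2)%N => /addnI ->.
case e : [seq _ <- _ | _] => [|l [|m [|]]] // _; exists l, m.
have : uniq [seq p <- enum 'I_5 | p \notin [:: i; j; k]].
  exact: filter_uniq (enum_uniq _).
rewrite e => ulm; rewrite -[X in uniq X]/([:: i; j; k] ++ [:: l; m]) cat_uniq u ulm /=.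
rewrite orbF andbT negb_or.
have hp p : p \in [:: l; m] -> p \notin [:: i; j; k].
  by rewrite -e mem_filter => /andP[].
by rewrite !hp ?inE ?eqxx ?orbT.
Qed.

Lemma uniq_complete2 (m m' : 'I_5) : m != m' ->
  exists i j k, uniq [:: i; j; k; m; m'].
Proof.
move=> mm; have [p pm] : exists p, p \notin [:: m; m'].
  case: (boolP [exists p, p \notin [:: m; m']]) => [/existsP//|].
  rewrite negb_exists => /forallP h.
  have := @uniq_leq_size _ (enum 'I_5) [:: m; m'] (enum_uniq _).
  rewrite size_enum_ord => h5; have // : (5 <= 2)%N.
  by apply: h5 => p _; rewrite -[_ \in _]negbK.
have [|l [k u]] := @uniq_complete3 m m' p.
  by move: pm; rewrite /= !inE !negb_or mm !(eq_sym _ p) andbT => ->.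
by exists p, l, k; uniq_by_perm u.
Qed.

Section Five.
Variable R : realFieldType.
Variable c : 'I_5 -> 'I_5 -> R.
Hypothesis ec : exposing c.
Let sc := exposing_sym ec.
Let cc := exposing_copos ec.

Lemma zero_supp3 u i j k l m : uniq [:: i; j; k; l; m] -> zero_of c u ->
  0 < u i -> 0 < u j -> 0 < u k -> u l = 0 /\ u m = 0.
Proof.
move=> us zu ui uj uk.
have aux a b : uniq [:: i; j; k; a; b] -> u a = 0.
  move=> us'; apply: contra_notP (fun h => exposing_zero_small ec (m := b) zu h).
  move=> /eqP ua p pb; have := mem_uniq5 us' (erefl _) p.
  rewrite !inE (negPf pb) orbF => /or4P[] /eqP-> //.
  by rewrite lt_def ua zu.1.
split; first exact: aux us.
by apply: (aux m l); uniq_by_perm us.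
Qed.

Lemma lin5 u i j k l m p : uniq [:: i; j; k; l; m] ->
  lin c u p = c p i * u i + c p j * u j + c p k * u k + c p l * u l + c p m * u m.
Proof. by move=> us; rewrite /lin (sum_uniq5 _ us). Qed.

(** The basis vector at [i] is a zero, so row [i] is nonnegative; a zero positive at [i] and [j] is
    annihilated by that row, term by term. *)
Lemma row_eq0 i : c i i = 0 -> forall j, c i j = 0.
Proof.
move=> cii; have zi : zero_of c (dl R i).
  by split=> [j|]; rewrite ?/dl ?ler0n // /qf bil_dl lin_dl.
have cge0 j : 0 <= c i j.
  by rewrite sc; have := zero_lin_ge0 sc cc j zi; rewrite lin_dl.
move=> j; have [b [zb bi bj]] := exposing_cover ec i j.
have := zero_lin_eq0 sc cc zb bi; rewrite /lin => /psumr_eq0P.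
move=> /(_ (fun p _ => mulr_ge0 (cge0 p) (zb.1 p)) j isT) /eqP.
by rewrite mulf_eq0 (gt_eqF bj) orbF => /eqP.
Qed.

Lemma zero_add_row0 i u : c i i = 0 -> zero_of c u ->
  zero_of c (fun j => u j + 1 * dl R i j).
Proof.
move=> cii zu; apply: zero_add => //.
  by split=> [j|]; rewrite ?/dl ?ler0n // /qf bil_dl lin_dl.
by rewrite bilC // bil_dl /lin big1 // => j _; rewrite row_eq0 // mul0r.
Qed.

(** If [c i i = 0], the basis vector at [i] can be added to any zero. No second diagonal entry
    vanishes, as otherwise a zero covering two other indices would grow to four positive entries.
    Likewise any two other indices [j], [k] carry a zero with support i, j, k, which forces
    [c j k < 0]; but then [lin c u l < 0] at a further index [l]. *)
Lemma exposing_diag_gt0 i : 0 < c i i.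
Proof.
have dge0 p : 0 <= c p p.
  have := cc (x := dl R p); rewrite /qf bil_dl lin_dl; apply => q.
  by rewrite /dl ler0n.
rewrite lt_def dge0 andbT; apply/eqP => cii.
have dgt0 (y : 'I_5 -> R) a b : (forall p, 0 <= y p) -> 0 < y b \/ b = a ->
    0 < y b + 1 * dl R a b.
  move=> y0 [yb|->]; last by rewrite /dl eqxx mul1r ltr_wpDl.
  by rewrite mul1r ltr_wpDr // /dl ler0n.
have d0 j : j != i -> c j j != 0.
  move=> ji; apply/eqP => cjj; have [k [l [m us]]] := uniq_complete2 ji.
  have [b [zb bk bl]] := exposing_cover ec k l.
  have z2 := zero_add_row0 cjj (zero_add_row0 cii zb).
  apply: (exposing_zero_small (m := m) ec z2) => p pm.
  have := mem_uniq5 us (erefl _) p.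
  have d1 : 0 <= dl R i p by exact: ler0n.
  have d2 : 0 <= dl R j p by exact: ler0n.
  have b0 := zb.1 p; rewrite !inE (negPf pm) /=.
  have dd q : dl R q q = 1 by rewrite /dl eqxx.
  case/or4P => /eqP ep; subst p; rewrite ?dd; lra.
have mk j k l m : uniq [:: i; j; k; l; m] ->
    exists u, [/\ zero_of c u, 0 < u j, 0 < u k, u l = 0 & u m = 0].
  move=> us; have [b [zb bj bk]] := exposing_cover ec j k.
  have zu := zero_add_row0 cii zb.
  have uj := dgt0 b i j zb.1 (or_introl bj).
  have uk := dgt0 b i k zb.1 (or_introl bk).
  have ui := dgt0 b i i zb.1 (or_intror (erefl _)).
  have [ul um] := zero_supp3 us zu ui uj uk.
  by exists (fun p => b p + 1 * dl R i p).
have neg j k l m : uniq [:: i; j; k; l; m] -> c j k < 0.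
  move=> us; have [u [zu uj uk ul um]] := mk _ _ _ _ us.
  have := zero_lin_eq0 sc cc zu uj; rewrite (lin5 _ _ us) ul um (sc j i) row_eq0 //.
  move=> e; have cjj : 0 < c j j.
    by rewrite lt_def dge0 d0 //; move: us; rewrite /= !inE negb_or eq_sym => /andP[/andP[]].
  have : c j k * u k < 0 by have := mulr_gt0 cjj uj; move: e; lra.
  by rewrite pmulr_llt0.
have [j [k [l [m us]]]] : exists j k l m, uniq [:: i; j; k; l; m].
  have [j ji] : exists j : 'I_5, j != i.
    have [->|i0] := eqVneq i ord0; first by exists ord_max.
    by exists ord0; rewrite eq_sym.
  have [k [l [m us]]] := uniq_complete2 ji; exists j, k, l, m.
  by uniq_by_perm us.
have [u [zu uj uk ul um]] := mk _ _ _ _ us.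
have := zero_lin_ge0 sc cc l zu; rewrite (lin5 _ _ us) ul um (sc l i) row_eq0 //.
have us2 : uniq [:: i; l; j; k; m].
  by uniq_by_perm us.
have us3 : uniq [:: i; l; k; j; m].
  by uniq_by_perm us.
have := neg _ _ _ _ us2; have := neg _ _ _ _ us3 => clk clj.
have : c l j * u j < 0 by rewrite pmulr_llt0.
have : c l k * u k < 0 by rewrite pmulr_llt0.
lra.
Qed.

End Five.

(** * Diagonal scaling and relabelling of forms *)

Section Rescale.
Variables (R : realFieldType) (n : nat).
Implicit Types (s : {perm 'I_n}) (d : 'I_n -> R) (c : 'I_n -> 'I_n -> R).

Definition rescale s d c : 'I_n -> 'I_n -> R :=
  fun i j => d i * d j * c (s i) (s j).

Lemma qf_rescale s d c x : (forall i, d i != 0) ->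
  qf (rescale s d c) (fun i => x (s i) / d i) = qf c x.
Proof.
move=> d0; rewrite /qf /bil [RHS](reindex_inj (@perm_inj _ s)).
apply: eq_bigr => i _; rewrite /lin [in RHS](reindex_inj (@perm_inj _ s)).
rewrite !mulr_sumr; apply: eq_bigr => j _; rewrite /rescale.
by field; rewrite !d0.
Qed.

Lemma qf_rescaleV s d c x : (forall i, d i != 0) ->
  qf (rescale s d c) x = qf c (fun p => d ((s^-1)%g p) * x ((s^-1)%g p)).
Proof.
move=> d0; rewrite -(qf_rescale s c _ d0); apply: eq_qf => i.
by rewrite permK mulrAC divff ?mul1r.
Qed.

Lemma copos_rescale s d c : (forall i, 0 < d i) -> copos c ->
  copos (rescale s d c).
Proof.
move=> d0 cc x x0; rewrite qf_rescaleV => [|i]; last by rewrite gt_eqF.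
by apply: cc => i; rewrite mulr_ge0 // ltW.
Qed.

Lemma zero_rescale s d c u : (forall i, 0 < d i) -> zero_of c u ->
  zero_of (rescale s d c) (fun i => u (s i) / d i).
Proof.
move=> d0 [u0 qu]; split=> [i|]; first by rewrite divr_ge0 // ltW.
by rewrite qf_rescale // => i; rewrite gt_eqF.
Qed.

Lemma exposing_rescale s d c : (forall i, 0 < d i) -> exposing c ->
  exposing (rescale s d c).
Proof.
move=> d0 [sc cc [i0 [j0 n0]] cov span]; split.
- by move=> i j; rewrite /rescale sc (mulrC (d i)).
- exact: copos_rescale.
- exists ((s^-1)%g i0), ((s^-1)%g j0); rewrite /rescale !permKV.
  by rewrite !mulf_neq0 // gt_eqF.
- move=> i j; have [u [zu ui uj]] := cov (s i) (s j).
  exists (fun i => u (s i) / d i).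
  by split; rewrite ?divr_gt0 //; exact: zero_rescale.
- move=> x hx i; have := span (fun p => x ((s^-1)%g p) / d ((s^-1)%g p)) _ (s i).
  rewrite permK => h; have /eqP : x i / d i = 0.
    apply: h => u /(zero_rescale s d0) /hx e; rewrite -[RHS]e.
    rewrite [LHS](reindex_inj (@perm_inj _ s)); apply: eq_bigr => j _.
    by rewrite permK mulrAC -mulrA.
  by rewrite mulf_eq0 invr_eq0 (gt_eqF (d0 i)) orbF => /eqP.
Qed.

End Rescale.

Lemma uniq5_compl (i j k l m p : 'I_5) : uniq [:: i; j; k; l; m] ->
  (p \in [:: i; j; k]) = (p != l) && (p != m).
Proof.
move=> us; have := mem_uniq5 us (erefl _) p.
rewrite -[X in p \in X]/([:: i; j; k] ++ [:: l; m]) mem_cat.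
move: us; rewrite -[X in uniq X]/([:: i; j; k] ++ [:: l; m]) cat_uniq.
case/and3P=> _ /hasPn h _ hp; rewrite -negb_or; case: (boolP (p \in [:: l; m])).
  by move=> pl; rewrite (negPf (h p pl)); move: pl; rewrite !inE => ->.
by move=> pl; move: hp; rewrite (negPf pl) orbF => ->; move: pl; rewrite !inE => ->.
Qed.

(** * Configurations of zeros excluded for a form with unit diagonal *)

Section UnitDiagonal.
Variable R : realFieldType.
Variable c : 'I_5 -> 'I_5 -> R.
Hypothesis ec : exposing c.
Hypothesis c1 : forall i, c i i = 1.
Let sc := exposing_sym ec.
Let cc := exposing_copos ec.

(** The factor 1 keeps the shape [x + t u], so that [lin_comb] and [bil_combl] apply as they
    stand. *)
Definition ez (i j : 'I_5) : 'I_5 -> R := fun p => dl R i p + 1 * dl R j p.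

Lemma lin_ez i j k : lin c (ez i j) k = c k i + c k j.
Proof. by rewrite lin_comb !lin_dl mul1r. Qed.

Lemma bil_ez i j (x : 'I_5 -> R) : bil c (ez i j) x = lin c x i + lin c x j.
Proof. by rewrite bil_combl !bil_dl mul1r. Qed.

Lemma ez_gt0 i j p : (0 < ez i j p) = (p \in [:: i; j]).
Proof.
by rewrite /ez /dl mul1r !inE -natrD ltr0n; do 2 case: (_ == _).
Qed.

Lemma exposing_entry i j : -1 <= c i j <= 1.
Proof.
have [b [zb bi bj]] := exposing_cover ec i j.
have q t : 0 <= qf c (fun p => dl R i p + t * dl R j p).
  apply: (qf_supp_ge0 sc cc zb) => p bp; rewrite /dl.
  case: eqVneq => [e|_]; first by move: bi; rewrite -e bp ltxx.
  case: eqVneq => [e|_]; first by move: bj; rewrite -e bp ltxx.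
  by rewrite add0r mulr0.
have := q 1; have := q (-1).
by rewrite !qf_comb // /qf !bil_dl !lin_dl !c1; lra.
Qed.

Lemma zero_ez i j : c i j = -1 -> zero_of c (ez i j).
Proof.
move=> cij; split=> [p|]; first by rewrite /ez mul1r addr_ge0 // ler0n.
by rewrite /qf bil_ez !lin_ez (sc j i) cij !c1; ring.
Qed.

(** The first edge gives a zero at which the linear form of row [k] is [c k i - 1]; its sign meets
    the upper bound of [exposing_entry]. *)
Lemma two_edges i j k : c i j = -1 -> c j k = -1 -> c i k = 1.
Proof.
move=> cij cjk; have := zero_lin_ge0 sc cc k (zero_ez cij).
by rewrite lin_ez (sc k j) cjk (sc k i); have := exposing_entry i k; lra.
Qed.

Lemma zero_eq0 u p : zero_of c u -> (0 < u p) = false -> u p = 0.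
Proof. by move=> zu up; apply: contraFeq up => h; rewrite lt_def h zu.1. Qed.

(** The last condition keeps the support minimal: no edge zero lives inside it. *)
Definition tight (i j k : 'I_5) (u : 'I_5 -> R) :=
  [/\ zero_of c u, (forall p, (0 < u p) = (p \in [:: i; j; k])) &
      forall p q, p \in [:: i; j; k] -> q \in [:: i; j; k] -> c p q != -1].

Lemma tight_perm i j k i' j' k' u : perm_eq [:: i; j; k] [:: i'; j'; k'] ->
  tight i j k u -> tight i' j' k' u.
Proof.
move=> /perm_mem e [zu up ne]; split=> // [p|p q]; first by rewrite -e.
by rewrite -!e; exact: ne.
Qed.

Lemma tight_lin i j k l m u p : uniq [:: i; j; k; l; m] -> tight i j k u ->
  lin c u p = c p i * u i + c p j * u j + c p k * u k.
Proof.
move=> us [zu up _]; rewrite (lin5 _ _ _ us).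
suff [-> ->] : u l = 0 /\ u m = 0 by ring.
by apply: (zero_supp3 ec us zu); rewrite up !inE eqxx ?orbT.
Qed.

(** With [c i j = 1] the first two equations of the singular 3 by 3 block make [c i k] and [c j k]
    equal, and the third makes their square 1. The value -1 is excluded by tightness; with 1,
    positive numbers would sum to 0. *)
Lemma tight_neq1 i j k u : uniq [:: i; j; k] -> tight i j k u ->
  c i j != 1 /\ -1 < c i j < 1.
Proof.
move=> u3 tu; have [l [m us]] := uniq_complete3 u3.
have lu p := tight_lin p us tu; case: (tu) => zu up ne.
have [ui uj uk] : [/\ 0 < u i, 0 < u j & 0 < u k].
  by rewrite !up !inE !eqxx ?orbT.
have := zero_lin_eq0 sc cc zu ui; have := zero_lin_eq0 sc cc zu uj.
have := zero_lin_eq0 sc cc zu uk.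
rewrite !lu !c1 (sc j i) (sc k i) (sc k j) => ek ej ei.
have cij : c i j != -1 by apply: ne; rewrite !inE eqxx ?orbT.
have cik : c i k != -1 by apply: ne; rewrite !inE eqxx ?orbT.
suff h : c i j != 1.
  split=> //; have := exposing_entry i j.
  by rewrite !lt_def !le_eqVlt eq_sym (eq_sym 1) (negPf h) (negPf cij) /=.
apply/eqP => c11; rewrite c11 !mul1r in ek ej ei.
have /eqP : (c i k - c j k) * u k = 0 by lra.
rewrite mulf_eq0 (gt_eqF uk) orbF subr_eq0 => /eqP e.
have /eqP : (c i k ^+ 2 - 1) * u k = 0.
  have -> : (c i k ^+ 2 - 1) * u k
     = c i k * (1 * u i + 1 * u j + c i k * u k) - (c i k * u i + c i k * u j + 1 * u k) by ring.
  move: ek ej ei; rewrite -e !mul1r => -> -> _; ring.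
rewrite mulf_eq0 (gt_eqF uk) orbF subr_eq0 sqrf_eq1 (negPf cik) orbF => /eqP c12.
by move: ei; rewrite c12; lra.
Qed.

Lemma no_triangle i j k : c i j = -1 -> c j k = -1 -> c i k = -1 -> False.
Proof. by move=> ij jk ik; have := two_edges ij jk; rewrite ik; lra. Qed.

(** The three edge zeros are orthogonal for the form, so their sum is a zero with four positive
    entries. The four-cycle is excluded in the same way by adding two opposite edges. *)
Lemma no_claw i j k l m : uniq [:: i; j; k; l; m] ->
  c i j = -1 -> c i k = -1 -> c i l = -1 -> False.
Proof.
move=> us ij ik il.
have [jk jl kl] : [/\ c j k = 1, c j l = 1 & c k l = 1].
  by split; apply: (two_edges (j := i)); rewrite // sc.
have zjk : zero_of c (fun p => ez i j p + 1 * ez i k p).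
  apply: zero_add => //; try exact: zero_ez.
  by rewrite bil_ez !lin_ez c1 ik (sc j i) ij jk; ring.
have z3 := zero_add sc zjk (zero_ez il) _.
apply: (exposing_zero_small (m := m) ec (z3 _)) => [|p pm].
  by rewrite bil_combl !bil_ez !lin_ez c1 il (sc j i) (sc k i) ij ik jl kl; ring.
have d0 a : 0 <= dl R a p by exact: ler0n.
have := mem_uniq5 us (erefl _) p; rewrite !inE (negPf pm) orbF /ez.
have d1 a : dl R a a = 1 by rewrite /dl eqxx.
have := d0 i; have := d0 j; have := d0 k; have := d0 l => h1 h2 h3 h4.
by case/or4P => /eqP e; subst p; move: h1 h2 h3 h4; rewrite ?d1; lra.
Qed.

Lemma no_four_cycle i j k l m : uniq [:: i; j; k; l; m] ->
  c i j = -1 -> c j k = -1 -> c k l = -1 -> c l i = -1 -> False.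
Proof.
move=> us ij jk kl li.
have ik : c i k = 1 by apply: two_edges jk.
have jl : c j l = 1 by apply: two_edges kl.
have z2 := zero_add sc (zero_ez ij) (zero_ez kl) _.
apply: (exposing_zero_small (m := m) ec (z2 _)) => [|p pm].
  by rewrite bil_ez !lin_ez ik jl (sc i l) li jk; ring.
have e0 a b : 0 <= ez a b p by rewrite /ez mul1r addr_ge0 // ler0n.
rewrite mul1r; have := mem_uniq5 us (erefl _) p; rewrite !inE (negPf pm) orbF orbA.
case/orP => h; first by rewrite ltr_wpDr // ez_gt0 !inE.
by rewrite ltr_wpDl // ez_gt0 !inE.
Qed.

Lemma no_tight_edge i j k u : tight i j k u -> c i j = -1 -> False.
Proof.
by case=> _ _ ne ij; have := ne i j; rewrite !inE !eqxx orbT ij eqxx => /(_ isT isT).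
Qed.

Lemma no_tight_path i j k l u : uniq [:: i; k; l] -> tight i k l u ->
  c i j = -1 -> c j k = -1 -> False.
Proof.
move=> us tu ij jk; have [] := tight_neq1 us tu.
by rewrite (two_edges ij jk) eqxx.
Qed.

Lemma tight_pair_cover i j k l m u v w : uniq [:: i; j; k; l; m] ->
  tight i j k u -> tight i j l v -> zero_of c w -> w m = 0 -> 0 < w k ->
  0 < w l -> False.
Proof.
move=> us [zu up _] [zv vp _] zw wm wk wl.
move: (us); rewrite /= !inE !negb_or => /and5P[/and4P[ij ik il im]
  /and3P[jk jl jm] /andP[kl km] lm _].
apply: (exposing_no_third (k := k) (l := l) (m := m) ec zu zv zw) => //.
- move=> p pl pm; have := mem_uniq5 us (erefl _) p.
  by rewrite up !inE (negPf pl) (negPf pm) !orbF.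
- by apply: zero_eq0; rewrite // up !inE !(eq_sym m) (negPf im) (negPf jm) (negPf km).
- move=> p pk pm; have := mem_uniq5 us (erefl _) p.
  by rewrite vp !inE (negPf pk) (negPf pm) !orbF.
Qed.

Lemma no_tight_pair_edge i j k l m u v : uniq [:: i; j; k; l; m] ->
  tight i j k u -> tight i j l v -> c k l = -1 -> False.
Proof.
move=> us tu tv kl; have zw := zero_ez kl.
apply: (tight_pair_cover us tu tv zw); rewrite ?ez_gt0 ?inE ?eqxx ?orbT //.
apply: zero_eq0 => //; rewrite ez_gt0 !inE.
move: us; rewrite /= !inE !negb_or => /and5P[_ _ /andP[_ km] lm _].
by rewrite !(eq_sym m) (negPf km) (negPf lm).
Qed.

Lemma no_three_tight i j k l m u v w : uniq [:: i; j; k; l; m] ->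
  tight i j k u -> tight i j l v -> tight i k l w -> False.
Proof.
move=> us tu tv [zw wp _].
apply: (tight_pair_cover us tu tv zw); rewrite ?wp ?inE ?eqxx ?orbT //.
apply: zero_eq0 => //; rewrite wp !inE.
move: us; rewrite /= !inE !negb_or => /and5P[/and4P[_ _ _ im] _ /andP[_ km] lm _].
by rewrite !(eq_sym m) (negPf im) (negPf km) (negPf lm).
Qed.

Lemma no_tight_star i j k l m u v w : uniq [:: i; j; k; l; m] ->
  tight i j k u -> tight i j l v -> tight i j m w -> False.
Proof.
move=> us [zu up _] [zv vp _] [zw wp _].
move: (us); rewrite /= !inE !negb_or => /and5P[/and4P[ij ik il im]
  /and3P[jk jl jm] /andP[kl km] lm _].
apply: (exposing_no_star (k := k) (l := l) (m := m) ec _ zu zv zw).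
- by rewrite /= !inE negb_or kl km lm.
- by move=> p; rewrite up (uniq5_compl _ us).
- have us' : uniq [:: i; j; l; k; m] by uniq_by_perm us.
  by move=> p; rewrite vp (uniq5_compl _ us').
- have us' : uniq [:: i; j; m; k; l] by uniq_by_perm us.
  by move=> p; rewrite wp (uniq5_compl _ us').
- exists i, j; split=> //; last exact: mem_uniq5 us (erefl _).
    by rewrite !inE !negb_or ik il im.
  by rewrite !inE !negb_or jk jl jm.
Qed.

End UnitDiagonal.

(** * Generators of the zeros and their number *)

Section Count.
Variable R : realFieldType.
Variable c : 'I_5 -> 'I_5 -> R.
Hypothesis ec : exposing c.
Hypothesis c1 : forall i, c i i = 1.
Let sc := exposing_sym ec.
Let cc := exposing_copos ec.

Lemma zero_two_zeros b : zero_of c b -> exists m m', [/\ m != m', b m = 0 & b m' = 0].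
Proof.
move=> zb; have h m : exists2 m', m' != m & b m' = 0.
  apply: contrapT => /forall2NP hm; apply: (exposing_zero_small (m := m) ec zb) => i im.
  have [//|bi] := hm i; rewrite lt_def zb.1 andbT; exact/eqP.
by have [m _ bm] := h ord0; have [m' mm bm'] := h m; exists m', m.
Qed.

Section Orthogonal.
Variable x : 'I_5 -> R.
Hypothesis x_edge : forall i j, i != j -> c i j = -1 -> x i + x j = 0.
Hypothesis x_tight : forall i j k u, uniq [:: i; j; k] -> tight c i j k u ->
  \sum_p x p * u p = 0.

(** If both entries are positive, the 2 by 2 block is singular, so [c i j] is 1 or -1; 1 contradicts
    positivity and -1 makes [b] a multiple of an edge zero. *)
Lemma orth_zero2 b i j k l m : uniq [:: i; j; k; l; m] -> zero_of c b ->
  b k = 0 -> b l = 0 -> b m = 0 -> \sum_p x p * b p = 0.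
Proof.
move=> us zb bk bl bm; rewrite (sum_uniq5 _ us) bk bl bm !mulr0 !addr0.
have lb p : lin c b p = c p i * b i + c p j * b j.
  by rewrite (lin5 _ _ _ us) bk bl bm; ring.
have [bi|bi] := eqVneq (b i) 0; have [bj|bj] := eqVneq (b j) 0.
- by rewrite bi bj; ring.
- have /(zero_lin_eq0 sc cc zb) : 0 < b j by rewrite lt_def bj zb.1.
  by rewrite lb c1 bi mulr0 add0r mul1r => ->; ring.
- have /(zero_lin_eq0 sc cc zb) : 0 < b i by rewrite lt_def bi zb.1.
  by rewrite lb c1 bj mulr0 addr0 mul1r => ->; ring.
have bi0 : 0 < b i by rewrite lt_def bi zb.1.
have bj0 : 0 < b j by rewrite lt_def bj zb.1.
have := zero_lin_eq0 sc cc zb bi0; have := zero_lin_eq0 sc cc zb bj0.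
rewrite !lb !c1 (sc j i) !mul1r => ej ei.
have /eqP : (c i j ^+ 2 - 1) * b j = 0.
  have -> : (c i j ^+ 2 - 1) * b j
    = c i j * (b i + c i j * b j) - (c i j * b i + b j) by ring.
  by rewrite ei ej mulr0 subrr.
rewrite mulf_eq0 (negPf bj) orbF subr_eq0 sqrf_eq1 => /orP[] /eqP cij.
  by move: ei; rewrite cij; lra.
have ij : i != j by move: us; rewrite /= !inE !negb_or => /andP[/andP[]].
have xe := x_edge ij cij.
have -> : b j = b i by move: ei; rewrite cij; lra.
by rewrite -mulrDl xe mul0r.
Qed.

(** An edge inside the support forces a second one, at [i k] or at [j k], and [b] is a combination
    of the two edge zeros. *)
Lemma orth_zero3 b i j k l m : uniq [:: i; j; k; l; m] -> zero_of c b ->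
  0 < b i -> 0 < b j -> 0 < b k -> b l = 0 -> b m = 0 -> c i j = -1 ->
  \sum_p x p * b p = 0.
Proof.
move=> us zb bi bj bk bl bm cij; rewrite (sum_uniq5 _ us) bl bm !mulr0 !addr0.
have lb p : lin c b p = c p i * b i + c p j * b j + c p k * b k.
  by rewrite (lin5 _ _ _ us) bl bm; ring.
have := zero_lin_eq0 sc cc zb bi; have := zero_lin_eq0 sc cc zb bj.
have := zero_lin_eq0 sc cc zb bk.
rewrite !lb !c1 (sc j i) (sc k i) (sc k j) cij !mul1r => ek ej ei.
have /eqP : (c i k + c j k) * b k = 0 by lra.
rewrite mulf_eq0 (gt_eqF bk) orbF addr_eq0 => /eqP e.
have /eqP : (c j k ^+ 2 - 1) * b k = 0.
  have -> : (c j k ^+ 2 - 1) * b k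
    = c j k * (-1 * b i + b j + c j k * b k) - (- c j k * b i + c j k * b j + b k) by ring.
  by rewrite ej -e ek mulr0 subrr.
rewrite mulf_eq0 (gt_eqF bk) orbF subr_eq0 sqrf_eq1.
move: (us); rewrite /= !inE !negb_or => /andP[/and4P[ij ik _ _] /andP[/andP[jk _] _]].
have xij := x_edge ij cij.
have xi : x i = - x j by lra.
case/orP => /eqP cjk.
  have cik : c i k = -1 by rewrite e cjk.
  have -> : b i = b j + b k by move: ei; rewrite cik; lra.
  have xik := x_edge ik cik; have -> : x k = x j by lra.
  by rewrite xi; ring.
have -> : b j = b i + b k by move: ej; rewrite cjk; lra.
have xjk := x_edge jk cjk; have -> : x k = - x j by lra.
by rewrite xi; ring.
Qed.

Lemma orth_zero b : zero_of c b -> \sum_p x p * b p = 0.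
Proof.
move=> zb; have [l [m [lm bl bm]]] := zero_two_zeros zb.
have [i [j [k us]]] := uniq_complete2 lm.
have usi : uniq [:: j; k; i; l; m] by uniq_by_perm us.
have usj : uniq [:: i; k; j; l; m] by uniq_by_perm us.
have [bi|bi] := eqVneq (b i) 0; first exact: (orth_zero2 usi).
have [bj|bj] := eqVneq (b j) 0; first exact: (orth_zero2 usj).
have [bk|bk] := eqVneq (b k) 0; first exact: (orth_zero2 us).
have bi0 : 0 < b i by rewrite lt_def bi zb.1.
have bj0 : 0 < b j by rewrite lt_def bj zb.1.
have bk0 : 0 < b k by rewrite lt_def bk zb.1.
have [cij|cij] := eqVneq (c i j) (-1); first exact: (orth_zero3 us).
have [cik|cik] := eqVneq (c i k) (-1); first exact: (orth_zero3 usj).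
have [cjk|cjk] := eqVneq (c j k) (-1); first exact: (orth_zero3 usi).
have u3 : uniq [:: i; j; k].
  by move: us; rewrite -[X in uniq X]/([:: i; j; k] ++ [:: l; m]) cat_uniq => /andP[].
apply: (x_tight (i := i) (j := j) (k := k)) => //; split=> // [p|p q].
  rewrite (uniq5_compl _ us).
  have [->|pl] := eqVneq p l; first by rewrite bl ltxx.
  have [->|pm] := eqVneq p m; first by rewrite bm ltxx.
  have := uniq5_compl p us; rewrite pl pm !inE.
  by case/or3P => /eqP->.
have n1 a : c a a != -1 by rewrite c1; apply/eqP; lra.
rewrite !inE => /or3P[] /eqP-> /or3P[] /eqP->; rewrite ?n1 //.
- by rewrite sc.
- by rewrite sc.
- by rewrite sc.
Qed.
End Orthogonal.

(** A generator is named by its support as a sorted list of naturals, the form in which the search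
    handles it. *)
Definition generator (s : seq nat) (u : 'I_5 -> R) : Prop :=
  (exists i j : 'I_5, [/\ i != j, s = edge i j, c i j = -1 & u = ez R i j]) \/
  (exists i j k : 'I_5, [/\ uniq [:: i; j; k], s = triple i j k & tight c i j k u]).

Lemma sorted_map_perm (a b : seq 'I_5) :
  sort leq [seq val i | i <- a] = sort leq [seq val i | i <- b] -> perm_eq a b.
Proof.
by move/(perm_sortP leq_total leq_trans anti_leq)/(perm_map_inj val_inj).
Qed.

Lemma generator_edge (i j : 'I_5) u : i != j -> generator (edge i j) u -> c i j = -1.
Proof.
move=> ij [[i' [j' [_ e cij _]]]|[i' [j' [k' [_ e _]]]]]; last first.
  by have := congr1 size e; rewrite !size_sort.
have /perm_mem pm := @sorted_map_perm [:: i; j] [:: i'; j'] e.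
have := pm i; have := pm j; rewrite !inE !eqxx orbT /=.
move=> /esym/orP[] /eqP ej /esym/orP[] /eqP ei; subst i j => //.
- by rewrite eqxx in ij.
- by rewrite sc.
- by rewrite eqxx in ij.
Qed.

Lemma generator_triple (i j k : 'I_5) u : generator (triple i j k) u -> tight c i j k u.
Proof.
move=> [[i' [j' [_ e _ _]]]|[i' [j' [k' [_ e t]]]]].
  by have := congr1 size e; rewrite !size_sort.
apply: tight_perm t; rewrite perm_sym.
exact: (@sorted_map_perm [:: i; j; k] [:: i'; j'; k'] e).
Qed.

Lemma psd2_eq0 (a y z : R) : -1 < a < 1 ->
  y ^+ 2 + z ^+ 2 + 2 * a * y * z = 0 -> y = 0 /\ z = 0.
Proof.
move=> /andP[a1 a2] e.
have a3 : 0 < 1 - a ^+ 2 by rewrite (_ : _ - _ = (1 - a) * (1 + a)); [apply: mulr_gt0; lra|ring].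
have z2 : (y + a * z) ^+ 2 + (1 - a ^+ 2) * z ^+ 2 = 0 by rewrite -e; ring.
have h1 := sqr_ge0 (y + a * z); have h2 := mulr_ge0 (ltW a3) (sqr_ge0 z).
have z0 : z = 0.
  apply/eqP; rewrite -sqrf_eq0; have /eqP : (1 - a ^+ 2) * z ^+ 2 = 0 by lra.
  by rewrite mulf_eq0 (gt_eqF a3).
split=> //; apply/eqP; rewrite -sqrf_eq0 -e z0; apply/eqP; ring.
Qed.

(** The difference [v - t u] that vanishes at [i] is still isotropic and lives on [j], [k], where
    the form is definite because [c j k] lies strictly between -1 and 1. *)
Lemma tight_prop i j k u v : uniq [:: i; j; k] -> tight c i j k u -> zero_of c v ->
  (forall p, p \notin [:: i; j; k] -> v p = 0) ->
  forall p, v p = (v i / u i) * u p.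
Proof.
move=> u3 tu zv vp; have [l [m us]] := uniq_complete3 u3.
have u3' : uniq [:: j; k; i] by rewrite -(rot_uniq 2).
have pjk : perm_eq [:: i; j; k] [:: j; k; i] by rewrite -(perm_rot 1) perm_refl.
have [_ cjk] := tight_neq1 ec c1 u3' (tight_perm pjk tu).
case: tu => zu up ne; have ui : 0 < u i by rewrite up inE eqxx.
pose t := v i / u i; pose y p := v p + (- t) * u p.
have vl0 p : p \notin [:: i; j; k] -> u p = 0.
  by move=> h; apply: (zero_eq0 zu); rewrite up (negPf h).
have uslm : l \notin [:: i; j; k] /\ m \notin [:: i; j; k].
  by rewrite !(uniq5_compl _ us) !eqxx andbF.
have yi : y i = 0 by rewrite /y /t mulNr divfK ?subrr // gt_eqF.
have yl : y l = 0 by rewrite /y vp ?vl0 ?mulr0 ?addr0 //; case: uslm.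
have ym : y m = 0 by rewrite /y vp ?vl0 ?mulr0 ?addr0 //; case: uslm.
have qy : qf c y = 0.
  rewrite qf_comb // zu.2 zv.2 /bil big1 ?mulr0 ?addr0 // => p _.
  case: (boolP (p \in [:: i; j; k])) => [|/vp->]; last by rewrite mul0r.
  by rewrite -up => /(zero_lin_eq0 sc cc zu) ->; rewrite mulr0.
have [yj yk] : y j = 0 /\ y k = 0.
  apply: (psd2_eq0 cjk); rewrite -qy /qf /bil (sum_uniq5 _ us) !(lin5 _ _ _ us).
  by rewrite yi yl ym !c1 (sc k j); ring.
move=> p; suff : y p = 0 by rewrite /y -/t; lra.
have := mem_uniq5 us (erefl _) p.
by rewrite !inE => /orP[|/or4P[]] /eqP->.
Qed.

Lemma generator_orth s u v (x : 'I_5 -> R) : generator s u -> generator s v ->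
  \sum_p x p * u p = 0 -> \sum_p x p * v p = 0.
Proof.
move=> gu [[i [j [ij es cij ->]]]|[i [j [k [u3 es tv]]]]].
  subst s; case: gu => [[i' [j' [_ e _ ->]]]|[i' [j' [k' [_ e _]]]]]; last first.
    by have := congr1 size e; rewrite !size_sort.
  move=> x0; rewrite -[RHS]x0; have pm := @sorted_map_perm [:: i; j] [:: i'; j'] e.
  apply: eq_bigr => p _; congr (_ * _).
  have /seq.permP/(_ (pred1 p)) /= := pm; rewrite /ez /dl !mul1r -!natrD !addn0.
  by rewrite !(eq_sym p) => ->.
subst s; have tu := generator_triple gu.
have [zv vp _] := tv.
have nv p : p \notin [:: i; j; k] -> v p = 0.
  by move=> h; apply: (zero_eq0 zv); rewrite vp (negPf h).
have e := tight_prop u3 tu zv nv.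
move=> h; under eq_bigr do rewrite e mulrCA.
by rewrite -mulr_sumr h mulr0.
Qed.

Lemma generator_small s u : generator s u -> s \in small_supports.
Proof.
case=> [[i [j [+ -> _ _]]]|[i [j [k [+ -> _]]]]].
  by case: i j => [[|[|[|[|[|//]]]]] ?] [[|[|[|[|[|//]]]]] ?].
by case: i j k => [[|[|[|[|[|//]]]]] ?] [[|[|[|[|[|//]]]]] ?] [[|[|[|[|[|//]]]]] ?].
Qed.

Definition realized (s : seq nat) : bool := `[< exists u, generator s u >].

Lemma realizedP s : realized s -> exists u, generator s u.
Proof. by move/asboolP. Qed.

(* The zeros span, so there cannot be fewer generators than coordinates. *)
Lemma size_realized : (5 <= size [seq s <- small_supports | realized s])%N.
Proof.
rewrite leqNgt; apply/negP; set L := seq.filter _ _ => sL.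
have [U hU] : exists U : seq nat -> 'I_5 -> R, forall s, realized s -> generator s (U s).
  suff /choice[U hU] : forall s, exists u, realized s -> generator s u by exists U.
  move=> s.
  case: (boolP (realized s)) => [/realizedP[u gu]|_]; first by exists u.
  by exists (fun=> 0).
(* One generator per realized support suffices, by [generator_orth]. With fewer than five columns
   some nonzero [x] is orthogonal to all generators, hence to all zeros. *)
pose Z : 'M[R]_(5, size L) := \matrix_(p, q) U (nth [::] L q) p.
have : kermx Z != 0.
  by rewrite -mxrank_eq0 mxrank_ker -lt0n subn_gt0 (leq_ltn_trans (rank_leq_col Z)).
move/rowV0Pn => [x /sub_kermxP xZ] /negP; apply.
have orth s u : generator s u -> \sum_p x 0 p * u p = 0.
  move=> gu; have rs : realized s by apply/asboolP; exists u.
  apply: (generator_orth (hU s rs) gu).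
  have sL' : s \in L by rewrite mem_filter rs (generator_small gu).
  have ltq : (index s L < size L)%N by rewrite index_mem.
  have := congr1 (fun M : 'rV_(size L) => M 0 (Ordinal ltq)) xZ.
  rewrite !mxE => e; rewrite -[RHS]e; apply: eq_bigr => p _.
  by rewrite !mxE /= nth_index.
apply/eqP/rowP => i; rewrite mxE.
apply: (exposing_span ec (x := fun p => x 0 p)) => u zu.
apply: orth_zero => // [a b ab cab|a b d v uv tv].
  have := orth (edge a b) (ez R a b) (or_introl _ (ex_intro _ a (ex_intro _ b (And4 ab erefl cab erefl)))).
  move=> x0; rewrite -[RHS]x0 /ez; 
  under [RHS]eq_bigr do rewrite mul1r mulrDr mulrC (mulrC (x 0 _) (dl R b _)).
  by rewrite big_split /= !sum_dl.
apply: (orth (triple a b d)); right; exists a, b, d; split=> //.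
Qed.

Lemma bad_patterns_false (p : seq 'I_5) P : uniq p ->
  P \in bad_patterns (map val p) -> (forall s, s \in P -> realized s) -> False.
Proof.
case: p => [|i [|j [|k [|l [|m [|]]]]]] // us hP hr.
have re (a b : 'I_5) : a != b -> edge a b \in P -> c a b = -1.
  by move=> ab /hr /realizedP[u]; exact: generator_edge.
have rt (a b d : 'I_5) : triple a b d \in P -> exists u, tight c a b d u.
  by move=> /hr /realizedP[u] /generator_triple; exists u.
move: (us); rewrite /= !inE !negb_or => /and5P[/and4P[ij ik il im]
  /and3P[jk jl jm] /andP[kl km] lm _].
have li : l != i by rewrite eq_sym.
have ikl : uniq [:: i; k; l] by rewrite /= !inE !negb_or ik il kl.
move: hP; rewrite !inE.
(* All candidate facts are stated in every case, each guarded by membership in the pattern; after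
   the rewriting, the guards of the current pattern become [true]. *)
case/orP=> [|/or4P[||| /or4P[]]] /eqP eP; rewrite {}eP in re rt {hr};
  (have e1 := re i j ij); (have e2 := re j k jk); (have e3 := re i k ik);
  (have e4 := re i l il); (have e5 := re k l kl); (have e6 := re l i li);
  (have t1 := rt i j k); (have t2 := rt i j l); (have t3 := rt i k l);
  (have t4 := rt i j m);
  rewrite !inE !eqxx ?orbT in e1 e2 e3 e4 e5 e6 t1 t2 t3 t4.
- exact: (no_triangle ec c1 (e1 isT) (e2 isT) (e3 isT)).
- exact: (no_claw ec c1 us (e1 isT) (e3 isT) (e4 isT)).
- exact: (no_four_cycle ec c1 us (e1 isT) (e2 isT) (e5 isT) (e6 isT)).
- by have [u tu] := t1 isT; exact: (no_tight_edge tu (e1 isT)).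
- by have [u tu] := t3 isT; exact: (no_tight_path ec c1 ikl tu (e1 isT) (e2 isT)).
- have [u tu] := t1 isT; have [v tv] := t2 isT.
  exact: (no_tight_pair_edge ec c1 us tu tv (e5 isT)).
- have [u tu] := t1 isT; have [v tv] := t2 isT; have [w tw] := t3 isT.
  exact: (no_three_tight ec us tu tv tw).
- have [u tu] := t1 isT; have [v tv] := t2 isT; have [w tw] := t4 isT.
  exact: (no_tight_star ec us tu tv tw).
Qed.

Lemma all_patternsP f P : P \in all_patterns f ->
  exists (p : seq 'I_5) Q, [/\ uniq p, size p = 5%N, Q \in f (map val p) & P =i Q].
Proof.
rewrite mem_undup => /mapP[Q /flatten_mapP[p pp fQ] ->].
move: pp; rewrite mem_permutations => /[dup] /perm_mem pm pp.
have e : map val (map (inord : nat -> 'I_5) p) = p.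
  rewrite -map_comp map_id_in // => i; rewrite pm mem_iota /= => i5.
  by rewrite inordK.
exists (map inord p), Q; split; first last.
- by move=> s; rewrite mem_sort.
- by rewrite e.
- by rewrite size_map (perm_size pp).
by rewrite -(map_inj_uniq val_inj) e (perm_uniq pp) iota_uniq.
Qed.

Lemma exposing_cyclic : exists s : {perm 'I_5},
  (forall i, c (s i) (s (i + 1)) = -1) \/
  (forall i, exists u, tight c (s i) (s (i + 1)) (s (i + 1 + 1)) u).
Proof.
(* The search treats selections of exactly five supports, so five of the realized ones are kept. *)
pose L := take 5 [seq s <- small_supports | realized s].
have sub : subseq L small_supports := subseq_trans (take_subseq _ _) (filter_subseq _ _).
have sL : size L = 5%N by rewrite size_takel ?size_realized.
have rL s : s \in L -> realized s.
  by move/mem_take; rewrite mem_filter => /andP[].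
have [|] := searchP search_small_supports sub sL.
  case/hasP => P /all_patternsP[p [Q [up sp bQ eQ]]] /allP hP; exfalso.
  by apply: (bad_patterns_false up bQ) => s; rewrite -eQ => /hP /rL.
case/hasP => P /all_patternsP[p [Q [up sp cQ eQ]]] /allP hP.
have rQ s : s \in Q -> realized s.
  by rewrite -eQ => /hP; rewrite /= catrevE cats0 mem_rev => /rL.
have inj : injective (fun i : 'I_5 => nth ord0 p i).
  by move=> i j /eqP; rewrite nth_uniq ?sp // => /eqP /val_inj.
exists (perm inj); move: cQ.
case: p up sp inj => [|a [|b [|d [|e [|f [|]]]]]] // up _ inj.
move: (up); rewrite /= !inE !negb_or => /and5P[/and4P[ab _ _ af]
  /and3P[bd _ _] /andP[de _] ef _].
have fa : f != a by rewrite eq_sym.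
have re (x y : 'I_5) : x != y -> edge x y \in Q -> c x y = -1.
  by move=> xy /rQ /realizedP[u]; exact: generator_edge.
have rt (x y z : 'I_5) : triple x y z \in Q -> exists u, tight c x y z u.
  by move=> /rQ /realizedP[u] /generator_triple; exists u.
case/orP=> /eqP eP; rewrite {}eP in re rt.
  left => i; rewrite !permE.
  by case: i => [[|[|[|[|[|//]]]]] i5]; apply: re; rewrite // !inE eqxx ?orbT.
right => i; rewrite !permE.
by case: i => [[|[|[|[|[|//]]]]] i5]; apply: rt; rewrite // !inE eqxx ?orbT.
Qed.
End Count.

(** * Horn and Hildebrand forms *)

Lemma uniq_cycle5 (i : 'I_5) :
  uniq [:: i; i + 1; i + 1 + 1; i + 1 + 1 + 1; i + 1 + 1 + 1 + 1].
Proof. by case: i => [[|[|[|[|[|//]]]]] ?]. Qed.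

Lemma addr5 (i : 'I_5) : i + 1 + 1 + 1 + 1 + 1 = i.
Proof. by case: i => [[|[|[|[|[|//]]]]] ?]; apply/val_inj. Qed.

Definition cell (i : 'I_5) : seq 'I_5 := [:: i; i + 1; i + 1 + 1].

Lemma mem_cell i p : (p \in cell i) = (p != i + 1 + 1 + 1) && (p != i + 1 + 1 + 1 + 1).
Proof. exact: uniq5_compl (uniq_cycle5 i). Qed.

(** * A copositivity criterion from five cyclic zeros *)

Section Perturb.
Variable R : realFieldType.
Variables (c u : 'I_5 -> 'I_5 -> R).
Hypothesis sc : symf c.
Hypothesis c1 : forall i, c i i = 1.
Hypothesis c_next : forall i, -1 <= c i (i + 1) <= 1.
Hypothesis u_gt0 : forall i p, p \in cell i -> 0 < u i p.
Hypothesis u_eq0 : forall i p, p \notin cell i -> u i p = 0.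
Hypothesis u_lin0 : forall i p, p \in cell i -> lin c (u i) p = 0.
Hypothesis u_lin : forall i p, p \notin cell i -> 0 <= lin c (u i) p.

Let qu i : qf c (u i) = 0.
Proof.
rewrite /qf /bil big1 // => p _; case: (boolP (p \in cell i)) => [/u_lin0->|/u_eq0->].
  by rewrite mulr0.
by rewrite mul0r.
Qed.

Lemma zero_cyclic_system i : zero_of c (u i).
Proof.
split=> // p; case: (boolP (p \in cell i)) => [/u_gt0/ltW//|/u_eq0->//].
Qed.

Let peel i x t : 0 <= t -> (forall p, p \notin cell i -> 0 <= x p) ->
  0 <= qf c (fun p => x p + (- t) * u i p) -> 0 <= qf c x.
Proof.
move=> t0 xp; rewrite qf_comb // qu mulr0 addr0 => h.
have : 0 <= bil c x (u i).
  apply: sumr_ge0 => p _; case: (boolP (p \in cell i)) => pi.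
    by rewrite u_lin0 // mulr0.
  by rewrite mulr_ge0 ?xp ?u_lin.
by move=> /(mulr_ge0 t0); lra.
Qed.

Let psd_cell i x : (forall p, p \notin cell i -> x p = 0) -> 0 <= qf c x.
Proof.
move=> xp; have ui : 0 < u i (i + 1 + 1) by rewrite u_gt0 // !inE eqxx ?orbT.
(* Removing this multiple of [u i] does not change the value and leaves two coordinates, with a 2 by
   2 block of unit diagonal and off-diagonal entry in [-1, 1]. *)
pose t := x (i + 1 + 1) / u i (i + 1 + 1).
pose y p := x p + (- t) * u i p.
have -> : qf c x = qf c y.
  rewrite qf_comb // qu /bil big1 ?mulr0 ?addr0 // => p _.
  by case: (boolP (p \in cell i)) => [/u_lin0->|/xp->]; rewrite ?mulr0 ?mul0r.
have us := uniq_cycle5 i.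
have ny p : p \notin cell i -> y p = 0 by move=> h; rewrite /y xp // u_eq0 // mulr0 addr0.
have y2 : y (i + 1 + 1) = 0 by rewrite /y mulNr divfK ?subrr // gt_eqF.
rewrite /qf /bil (sum_uniq5 _ us) y2.
rewrite !(ny (i + 1 + 1 + 1)) ?(ny (i + 1 + 1 + 1 + 1)) ?mem_cell ?eqxx ?andbF //.
rewrite /lin !(sum_uniq5 _ us) y2.
rewrite !(ny (i + 1 + 1 + 1)) ?(ny (i + 1 + 1 + 1 + 1)) ?mem_cell ?eqxx ?andbF //.
rewrite !c1 (sc (i + 1) i); have /andP[] := c_next i.
set a := c i (i + 1); set b := y i; set d := y (i + 1) => a1 a2.
rewrite (_ : _ + _ = ((1 + a) * (b + d) ^+ 2 + (1 - a) * (b - d) ^+ 2) / 2); last by field.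
by rewrite divr_ge0 // addr_ge0 // mulr_ge0 ?sqr_ge0 //; lra.
Qed.

Let copos_facet m x : (forall p, 0 <= x p) -> x m = 0 -> 0 <= qf c x.
Proof.
move=> x0 xm; have um : 0 < u (m + 1) (m + 1) by rewrite u_gt0 // inE eqxx.
apply: (@peel (m + 1) x (x (m + 1) / u (m + 1) (m + 1))) => //.
  by rewrite divr_ge0 // ltW.
(* The cell at [m + 2] misses exactly [m] and [m + 1]; the latter entry has just been cancelled. *)
apply: (@psd_cell (m + 1 + 1)) => p.
rewrite mem_cell addr5 -negb_or negbK => /orP[] /eqP->.
  have mn : m \notin cell (m + 1) by rewrite mem_cell addr5 eqxx andbF.
  by rewrite xm add0r (u_eq0 mn) mulr0.
by rewrite mulNr divfK ?subrr // gt_eqF.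
Qed.

(* Subtracting from a nonnegative vector as much as possible of a zero [u i]
   only decreases the form and lands on a facet of the orthant; on a facet,
   the same step leads to a cell, where the form is semidefinite. *)
Lemma copos_cyclic_system : copos c.
Proof.
move=> x x0; pose r p := x p / u 0 p.
have [p p0 rp] : exists2 p, p \in cell 0 & forall q, q \in cell 0 -> r p <= r q.
  have i0 : (0 : 'I_5) \in cell 0 by rewrite inE eqxx.
  by case: (@arg_minP _ _ _ 0 (mem (cell 0)) r i0) => p pi h; exists p.
have up := u_gt0 p0.
apply: (@peel 0 x (r p)) => [|q _|]; rewrite ?divr_ge0 ?x0 // ?(ltW up) //.
apply: (@copos_facet p) => [q|]; last by rewrite mulNr divfK ?subrr // gt_eqF.
case: (boolP (q \in cell 0)) => [q0|/u_eq0->]; last by rewrite mulr0 addr0.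
have := rp q q0; rewrite /r ler_pdivlMr ?u_gt0 // mulNr subr_ge0 //.
Qed.
End Perturb.

Ltac case_ord5 i := case: i => [[|[|[|[|[|//]]]]] ?].

Section Hildebrand.
Variable R : realFieldType.
Implicit Types co si : 'I_5 -> R.

(* Hildebrand's matrix T(theta), with [co i] and [si i] standing for the cosine
   and sine of theta_i; [co = 1], [si = 0] gives the Horn matrix. *)
Definition hild co si (i j : 'I_5) : R :=
  if j == i then 1
  else if j == i + 1 then - co i
  else if i == j + 1 then - co j
  else if j == i + 1 + 1 then co i * co (i + 1) - si i * si (i + 1)
  else co j * co (j + 1) - si j * si (j + 1).

(** The entries are sin theta_{i+1}, sin (theta_i + theta_{i+1}) and sin theta_i: the kernel of the
    3 by 3 block of T(theta) on the cell. *)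
Definition hild_zero co si (i p : 'I_5) : R :=
  if p == i then si (i + 1)
  else if p == i + 1 then si i * co (i + 1) + co i * si (i + 1)
  else if p == i + 1 + 1 then si i
  else 0.

Lemma hild_sym co si : symf (hild co si).
Proof. by move=> i j; case_ord5 i; case_ord5 j. Qed.

Lemma hild_diag co si i : hild co si i i = 1.
Proof. by rewrite /hild eqxx. Qed.

Lemma hild_next co si i : hild co si i (i + 1) = - co i.
Proof. by case_ord5 i. Qed.

Lemma hild_next2 co si i :
  hild co si i (i + 1 + 1) = co i * co (i + 1) - si i * si (i + 1).
Proof. by case_ord5 i. Qed.

Lemma hild_zeroE co si i :
  [/\ hild_zero co si i i = si (i + 1),
      hild_zero co si i (i + 1) = si i * co (i + 1) + co i * si (i + 1),
      hild_zero co si i (i + 1 + 1) = si i &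
      forall p, p \notin cell i -> hild_zero co si i p = 0].
Proof.
split; try by case_ord5 i.
by move=> p; rewrite /hild_zero !inE; do 3 case: eqP => //.
Qed.

Lemma sym_cycleP (c c' : 'I_5 -> 'I_5 -> R) : symf c -> symf c' ->
  (forall i, c i i = c' i i) -> (forall i, c i (i + 1) = c' i (i + 1)) ->
  (forall i, c i (i + 1 + 1) = c' i (i + 1 + 1)) -> forall i j, c i j = c' i j.
Proof.
move=> sc sc' h0 h1 h2 i j.
have := mem_uniq5 (uniq_cycle5 i) (erefl _) j.
rewrite !inE => /orP[/eqP->//|/or4P[] /eqP-> //].
  by rewrite sc sc' -{2 4}(addr5 i).
by rewrite sc sc' -{2 4}(addr5 i).
Qed.

Lemma lin_cell (c : 'I_5 -> 'I_5 -> R) co si i p :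
  lin c (hild_zero co si i) p = c p i * si (i + 1)
    + c p (i + 1) * (si i * co (i + 1) + co i * si (i + 1)) + c p (i + 1 + 1) * si i.
Proof.
have [h0 h1 h2 h3] := hild_zeroE co si i.
rewrite (lin5 _ _ _ (uniq_cycle5 i)) h0 h1 h2 !h3 ?mem_cell ?eqxx ?andbF //.
by ring.
Qed.

(** Only the equation of the circle enters, so the zeros persist at rational points near the given
    angles. *)
Lemma hild_lin0 co si i p : (forall i, co i ^+ 2 + si i ^+ 2 = 1) ->
  p \in cell i -> lin (hild co si) (hild_zero co si i) p = 0.
Proof.
move=> cs; have e (a : 'I_5) : co a ^+ 2 = 1 - si a ^+ 2 by rewrite -(cs a); ring.
rewrite !inE => /or3P[] /eqP->; rewrite lin_cell.
- rewrite hild_diag hild_next hild_next2.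
  by transitivity (si (i + 1) * (1 - co i ^+ 2 - si i ^+ 2)); [ring|rewrite e; ring].
- rewrite hild_diag hild_next hild_sym hild_next.
  by transitivity (0 : R); ring.
- rewrite hild_diag [hild _ _ _ i]hild_sym hild_next2.
  rewrite [hild _ _ _ (i + 1)]hild_sym hild_next.
  by transitivity (si i * (1 - co (i + 1) ^+ 2 - si (i + 1) ^+ 2)); [ring|rewrite e; ring].
Qed.

Lemma hild_cyclic co si : (forall i, co i ^+ 2 + si i ^+ 2 = 1) ->
  (forall i, 0 < si i) -> (forall i, 0 < si i * co (i + 1) + co i * si (i + 1)) ->
  (forall i p, p \notin cell i -> 0 <= lin (hild co si) (hild_zero co si i) p) ->
  copos (hild co si) /\ forall i, zero_of (hild co si) (hild_zero co si i).
Proof.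
move=> cs s0 m0 l0.
have u0 i p : p \in cell i -> 0 < hild_zero co si i p.
  have [h0 h1 h2 _] := hild_zeroE co si i.
  by rewrite !inE => /or3P[] /eqP->; rewrite ?h0 ?h1 ?h2.
have un i p : p \notin cell i -> hild_zero co si i p = 0.
  by have [_ _ _] := hild_zeroE co si i; apply.
have ul i p : p \in cell i -> lin (hild co si) (hild_zero co si i) p = 0.
  exact: hild_lin0.
split=> [|i]; last exact: (zero_cyclic_system u0 un ul).
apply: (copos_cyclic_system (@hild_sym co si) _ _ u0 un ul l0) => i.
  exact: hild_diag.
rewrite hild_next; have := cs i; have := sqr_ge0 (si i) => h1 h2.
by have : `|co i| ^+ 2 <= 1 by [rewrite real_normK ?num_real //; lra];
  rewrite expr_le1 // ler_norml lerN2; lra.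
Qed.

Definition horn : 'I_5 -> 'I_5 -> R := hild (fun=> 1) (fun=> 0).

Lemma horn_next i : horn i (i + 1) = -1. Proof. exact: hild_next. Qed.

Lemma horn_next2 i : horn i (i + 1 + 1) = 1.
Proof. by rewrite /horn hild_next2; ring. Qed.

Lemma horn_copos : copos horn.
Proof.
(* The vectors [hild_zero] vanish when [si = 0]. The sum of two adjacent edge zeros, with entries 1,
   2, 1, replaces them in the criterion. *)
pose u (i p : 'I_5) : R := if p == i then 1 else if p == i + 1 then 2
  else if p == i + 1 + 1 then 1 else 0.
have uE i : [/\ u i i = 1, u i (i + 1) = 2, u i (i + 1 + 1) = 1 &
    forall p, p \notin cell i -> u i p = 0].
  by split; [case_ord5 i|case_ord5 i|case_ord5 i|move=> p; rewrite /u !inE; do 3 case: eqP => //].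
have un i p : p \notin cell i -> u i p = 0 by have [_ _ _] := uE i; apply.
have ul i p : lin horn (u i) p = horn p i + 2 * horn p (i + 1) + horn p (i + 1 + 1).
  have [u0 u1 u2 u3] := uE i.
  rewrite (lin5 _ _ _ (uniq_cycle5 i)) u0 u1 u2 !u3 ?mem_cell ?eqxx ?andbF //.
  by ring.
have hs := @hild_sym (fun=> 1) (fun=> 0).
have hd i : horn i i = 1 := hild_diag _ _ i.
apply: (copos_cyclic_system (u := u)) => // [i|i p|i p|i p].
- by rewrite horn_next lexx /= lerN1n1 || (apply/andP; split; rewrite ?horn_next; lra).
- have [u0 u1 u2 _] := uE i.
  by rewrite !inE => /or3P[] /eqP->; rewrite ?u0 ?u1 ?u2.
- rewrite ul !inE => /or3P[] /eqP->.
  + by rewrite hd horn_next horn_next2; ring.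
  + by rewrite hd horn_next [horn (i + 1) i]hs -/horn horn_next; ring.
  + rewrite hd [horn _ i]hs [horn _ (i + 1)]hs -/horn horn_next2 horn_next; ring.
- rewrite mem_cell -negb_or negbK ul => /orP[] /eqP->.
  + rewrite [horn _ (i + 1)]hs [horn _ (i + 1 + 1)]hs -/horn horn_next horn_next2.
    by rewrite -{2}(addr5 i) horn_next2; lra.
  + rewrite [horn _ (i + 1 + 1)]hs -/horn horn_next2 -{2 4}(addr5 i) horn_next horn_next2; lra.
Qed.
End Hildebrand.

(** * The form and its zeros in the two cyclic cases *)

Section CyclicZeros.
Variable R : rcfType.
Variable c : 'I_5 -> 'I_5 -> R.
Hypothesis ec : exposing c.
Hypothesis c1 : forall i, c i i = 1.
Let sc := exposing_sym ec.
Let cc := exposing_copos ec.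

(** A zero vanishes at two indices. Adjacent ones form the complement of a cell; for indices at
    distance two, the hypothesis supplies a vanishing entry adjacent to one of them. *)
Lemma zero_in_cell b :
  (forall m, b m = 0 -> b (m + 1 + 1) = 0 -> b (m + 1) = 0 \/ b (m + 1 + 1 + 1) = 0) ->
  zero_of c b -> exists i, forall p, p \notin cell i -> b p = 0.
Proof.
move=> hb zb.
have adj m : b m = 0 -> b (m + 1) = 0 -> exists i, forall p, p \notin cell i -> b p = 0.
  move=> b0 b1; exists (m + 1 + 1) => p.
  by rewrite mem_cell addr5 -negb_or negbK => /orP[] /eqP->.
have gap m : b m = 0 -> b (m + 1 + 1) = 0 -> exists i, forall p, p \notin cell i -> b p = 0.
  by move=> b0 b2; have [|] := hb m b0 b2; [exact: adj|exact: (adj (m + 1 + 1))].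
have [m [m' [mm bm bm']]] := zero_two_zeros ec zb.
have := mem_uniq5 (uniq_cycle5 m) (erefl _) m'; rewrite !inE eq_sym (negPf mm) /=.
case/or4P => /eqP e; subst m'.
- exact: (adj m).
- exact: (gap m).
- by apply: (gap _ bm'); rewrite addr5.
- by apply: (adj _ bm'); rewrite addr5.
Qed.

Section Horn.
Hypothesis c_next : forall i, c i (i + 1) = -1.

Lemma cyclic_horn i j : c i j = horn R i j.
Proof.
have hs : symf (horn R) := @hild_sym R (fun=> 1) (fun=> 0).
apply: (sym_cycleP sc hs) => {i j} i.
- by rewrite c1 [RHS]hild_diag.
- by rewrite c_next horn_next.
- by rewrite (two_edges ec c1 (c_next i) (c_next _)) horn_next2.
Qed.

Lemma horn_zero_shape b : zero_of c b -> exists i x y, [/\ 0 <= x, 0 <= y &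
  forall p, b p = x * ez R i (i + 1) p + y * ez R (i + 1) (i + 1 + 1) p].
Proof.
move=> zb.
have e i j : c i j = horn R i j by exact: cyclic_horn.
have hs : symf (horn R) := @hild_sym R (fun=> 1) (fun=> 0).
have hd i : horn R i i = 1 by exact: hild_diag.
have [|i bi] := zero_in_cell _ zb.
  (* Row [m + 1] of the Horn form has coefficient 1 at itself and at the two indices not known to
     vanish, so its value at [b] would be positive. *)
  move=> m b0 b2; left; apply/eqP; case: eqVneq => // b1; exfalso.
  have p1 : 0 < b (m + 1) by rewrite lt_def b1 zb.1.
  have := zero_lin_eq0 sc cc zb p1.
  have h3 i : horn R i (i + 1 + 1 + 1) = 1 by rewrite hs -[X in horn R _ X](addr5 i) horn_next2.
  rewrite (lin5 _ _ _ (uniq_cycle5 m)) b0 b2 c1 !e !mulr0 horn_next2 h3.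
  by have := zb.1 (m + 1 + 1 + 1); have := zb.1 (m + 1 + 1 + 1 + 1); lra.
have us := uniq_cycle5 i.
have [b3 b4] : b (i + 1 + 1 + 1) = 0 /\ b (i + 1 + 1 + 1 + 1) = 0.
  by rewrite !bi // mem_cell eqxx ?andbF.
have b1 : b (i + 1) = b i + b (i + 1 + 1).
  have := zb.2; rewrite /qf /bil (sum_uniq5 _ us) !(lin5 _ _ _ us) b3 b4 !e !hd.
  rewrite [horn R _ i]hs [horn R (i + 1 + 1) i]hs [horn R (i + 1 + 1) (i + 1)]hs.
  rewrite !horn_next !horn_next2 => q0.
  (* On three consecutive indices the Horn form is a perfect square. *)
  have /eqP : (b i - b (i + 1) + b (i + 1 + 1)) ^+ 2 = 0 by rewrite -[RHS]q0; ring.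
  by rewrite sqrf_eq0 => /eqP; lra.
exists i, (b i), (b (i + 1 + 1)); split; [exact: zb.1|exact: zb.1|].
move=> p; rewrite /ez /dl.
move: (us); rewrite /= !inE !negb_or => /and5P[/and4P[n1 n2 n3 n4]
  /and3P[n5 n6 n7] /andP[n8 n9] n10 _].
have nE := (negPf n1, negPf n2, negPf n3, negPf n4, negPf n5, negPf n6,
  negPf n7, negPf n8, negPf n9, negPf n10).
have := mem_uniq5 us (erefl _) p; rewrite !inE.
case/orP => [|/or4P[]] /eqP->; rewrite ?b1 ?b3 ?b4 ?eqxx.
- by rewrite !nE /=; ring.
- by rewrite [i + 1 == i]eq_sym !nE /=; ring.
- by rewrite [_ == i]eq_sym [_ == i + 1]eq_sym !nE /=; ring.
- by rewrite [_ == i]eq_sym [_ == i + 1]eq_sym [_ == i + 1 + 1]eq_sym !nE /=; ring.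
- by rewrite [_ == i]eq_sym [_ == i + 1]eq_sym [_ == i + 1 + 1]eq_sym !nE /=; ring.
Qed.
End Horn.

Section Tight.
Hypothesis c_tight : forall i, exists u, tight c i (i + 1) (i + 1 + 1) u.

(** Angles in (0, pi) are read off the entries [c i (i + 1)], which lie strictly between -1 and 1. A
    positive kernel vector of each 3 by 3 block then forces the entry at distance two to be the
    cosine of the sum of two consecutive angles. *)
Lemma cyclic_hild : exists co si : 'I_5 -> R, 
  [/\ forall i, co i ^+ 2 + si i ^+ 2 = 1, forall i, 0 < si i,
      forall i : 'I_5, 0 < si i * co (i + 1) + co i * si (i + 1),
      forall i j, c i j = hild co si i j &
      forall b, zero_of c b -> exists i t, 0 <= t /\ forall p, b p = t * hild_zero co si i p].
Proof.
have u3 (i : 'I_5) : uniq [:: i; i + 1; i + 1 + 1].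
  have := uniq_cycle5 i; rewrite -[X in uniq X]/(cell i ++ [:: i + 1 + 1 + 1; i + 1 + 1 + 1 + 1]).
  by rewrite cat_uniq => /andP[].
pose co (i : 'I_5) := - c i (i + 1); pose si i := Num.sqrt (1 - co i ^+ 2).
have c2 i : 0 < 1 - co i ^+ 2.
  have [u tu] := c_tight i; have [_ /andP[l1 l2]] := tight_neq1 ec c1 (u3 i) tu.
  rewrite (_ : _ - _ = (1 - c i (i + 1)) * (1 + c i (i + 1))); last by rewrite /co; ring.
  by apply: mulr_gt0; lra.
have s0 i : 0 < si i by rewrite sqrtr_gt0.
have cs i : co i ^+ 2 + si i ^+ 2 = 1 by rewrite sqr_sqrtr ?ltW //; ring.
have key i u : tight c i (i + 1) (i + 1 + 1) u ->
    [/\ c i (i + 1 + 1) = co i * co (i + 1) - si i * si (i + 1),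
        u i * si i = u (i + 1 + 1) * si (i + 1) &
        u (i + 1) = co i * u i + co (i + 1) * u (i + 1 + 1)].
  move=> tu; have lu p := tight_lin ec p (uniq_cycle5 i) tu; case: (tu) => zu up ne.
  have [x0 y0 z0] : [/\ 0 < u i, 0 < u (i + 1) & 0 < u (i + 1 + 1)].
    by rewrite !up !inE !eqxx ?orbT.
  have := zero_lin_eq0 sc cc zu x0; have := zero_lin_eq0 sc cc zu y0.
  have := zero_lin_eq0 sc cc zu z0.
  rewrite !lu !c1 [c (i + 1) i]sc [c (i + 1 + 1) i]sc [c (i + 1 + 1) (i + 1)]sc.
  have -> : c i (i + 1) = - co i by rewrite opprK.
  have -> : c (i + 1) (i + 1 + 1) = - co (i + 1) by rewrite opprK.
  move: (cs i) (cs (i + 1)) (s0 i) (s0 (i + 1)) x0 y0 z0.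
  move: (co i) (co (i + 1)) (si i) (si (i + 1)) (c i (i + 1 + 1)).
  move: (u i) (u (i + 1)) (u (i + 1 + 1)) => x y z a b s s' r cs1 cs2 s1 s2 x0 y0 z0 e3 e2 e1.
  have ey : y = a * x + b * z by lra.
  have f1 : x * s ^+ 2 = z * (a * b - r).
    rewrite (_ : s ^+ 2 = 1 - a ^+ 2); last by lra.
    by transitivity (x * (1 - a ^+ 2) - (1 * x + - a * y + r * z)); [rewrite e1 subr0|rewrite ey; ring].
  have f3 : z * s' ^+ 2 = x * (a * b - r).
    rewrite (_ : s' ^+ 2 = 1 - b ^+ 2); last by lra.
    by transitivity (z * (1 - b ^+ 2) - (r * x + - b * y + 1 * z)); [rewrite e3 subr0|rewrite ey; ring].
  have g0 : 0 < a * b - r.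
    by rewrite -(pmulr_rgt0 _ z0) -f1 mulr_gt0 // exprn_gt0.
  (* Multiplying [f1] and [f3] gives the equality of squares; both sides are nonnegative. *)
  have g : a * b - r = s * s'.
    apply/eqP; rewrite -(@eqrXn2 _ 2) ?(ltW g0) ?mulr_ge0 ?ltW //.
    have /mulfI xz : x * z != 0 by rewrite mulf_neq0 ?gt_eqF.
    apply/eqP/xz; rewrite exprMn.
    transitivity ((z * (a * b - r)) * (x * (a * b - r))); first by ring.
    by rewrite -f1 -f3; ring.
  split=> //; first by lra.
  have /mulIf : s != 0 by rewrite gt_eqF.
  by apply; move: f1; rewrite g; lra.
exists co, si; split=> //.
- move=> i; have [u tu] := c_tight i; have [_ e ey] := key i u tu.
  have [_ up _] := tu.
  have [x0 y0 z0] : [/\ 0 < u i, 0 < u (i + 1) & 0 < u (i + 1 + 1)].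
    by rewrite !up !inE !eqxx ?orbT.
  rewrite -(pmulr_rgt0 _ z0).
  have -> : u (i + 1 + 1) * (si i * co (i + 1) + co i * si (i + 1)) = u (i + 1) * si i.
    rewrite ey (_ : (_ + _) * si i =
      co i * (u i * si i) + co (i + 1) * u (i + 1 + 1) * si i); last by ring.
    by rewrite e; ring.
  by rewrite mulr_gt0.
- apply: (sym_cycleP sc (hild_sym _ _)) => i.
  + by rewrite c1 hild_diag.
  + by rewrite hild_next opprK.
  + by have [u tu] := c_tight i; have [-> _ _] := key i u tu; rewrite hild_next2.
move=> b zb; have [|i bi] := zero_in_cell _ zb.
  (* The tight triples starting at [m + 3] and [m + 4] share two indices, so [tight_pair_cover]
     forbids a zero that vanishes at [m + 2] and is positive at [m + 1] and [m + 3]. *)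
  move=> m b0 b2; have [u tu] := c_tight (m + 1 + 1 + 1).
  have [v tv] := c_tight (m + 1 + 1 + 1 + 1); rewrite addr5 in tu tv.
  have us : uniq [:: m + 1 + 1 + 1 + 1; m; m + 1 + 1 + 1; m + 1; m + 1 + 1].
    move: (uniq_cycle5 m) => {b0 b2 tu tv}.
    move: (m + 1) (m + 1 + 1) (m + 1 + 1 + 1) (m + 1 + 1 + 1 + 1) => p1 p2 p3 p4 us.
    by uniq_by_perm us.
  have tu' : tight c (m + 1 + 1 + 1 + 1) m (m + 1 + 1 + 1) u.
    by apply: tight_perm tu; rewrite -(perm_rot 1) perm_refl.
  have [b1|b1] := eqVneq (b (m + 1)) 0; first by left.
  have [b3|b3] := eqVneq (b (m + 1 + 1 + 1)) 0; first by right.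
  by exfalso; apply: (tight_pair_cover ec us tu' tv zb b2); rewrite lt_def ?b1 ?b3 zb.1.
have [u tu] := c_tight i; have [_ eu ey] := key i u tu.
have hp := tight_prop ec c1 (u3 i) tu zb bi.
have [_ up _] := tu; have u0 : 0 < u i by rewrite up inE eqxx.
have [h0 h1 h2 h3] := hild_zeroE co si i.
exists i, (b i / si (i + 1)); split=> [|p]; first by rewrite divr_ge0 ?zb.1 // ltW.
case: (boolP (p \in cell i)) => [|hpn]; last by rewrite bi // h3 // mulr0.
have n1 : si (i + 1) != 0 by rewrite gt_eqF.
have n2 : u i != 0 by rewrite gt_eqF.
have uz : u (i + 1 + 1) = u i * si i / si (i + 1) by rewrite eu mulfK.
rewrite !inE => /or3P[] /eqP->; rewrite ?h0 ?h1 ?h2.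
- by rewrite divfK.
- by rewrite hp ey uz; field; rewrite n1 n2.
- by rewrite hp uz; field; rewrite n1 n2.
Qed.
End Tight.
End CyclicZeros.

Import numFieldNormedType.Exports.
Local Open Scope classical_set_scope.
Local Open Scope ring_scope.

(** * Rational approximation *)

Section Rational.
Variable R : realType.

Lemma rationalD (x y : R) : rational x -> rational y -> rational (x + y).
Proof. by move=> [p _ <-] [q _ <-]; exists (p + q) => //; rewrite rmorphD. Qed.

Lemma rationalM (x y : R) : rational x -> rational y -> rational (x * y).
Proof. by move=> [p _ <-] [q _ <-]; exists (p * q) => //; rewrite rmorphM. Qed.

Lemma rationalN (x : R) : rational x -> rational (- x).
Proof. by move=> [p _ <-]; exists (- p) => //; rewrite rmorphN. Qed.

Lemma rationalV (x : R) : rational x -> rational x^-1.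
Proof. by move=> [p _ <-]; exists p^-1 => //; rewrite fmorphV. Qed.

Lemma rational_nat n : rational (n%:R : R).
Proof. by exists n%:R => //; rewrite ratr_nat. Qed.

Lemma rational_sum I (r : seq I) (F : I -> R) : (forall i, rational (F i)) ->
  rational (\sum_(i <- r) F i).
Proof.
move=> h; elim/big_rec: _ => [|i x _ hx]; first exact: (rational_nat 0).
exact: rationalD.
Qed.

(** Approaching from above makes all approximants of a nonnegative number positive, so sign
    conditions hold for every [n]. *)
Lemma rational_seq (x : R) : exists u : nat -> R,
  [/\ forall n, rational (u n), forall n, x < u n & u n @[n --> \oo] --> x].
Proof.
have /choice[u hu] : forall n : nat, exists q : rat, x < ratr q < x + n.+1%:R^-1.
  move=> n; have [|q] := @rat_in_itvoo R x (x + n.+1%:R^-1).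
    by rewrite ltrDl invr_gt0.
  by rewrite in_itv => ?; exists q.
exists (fun n => ratr (u n)); split=> [n|n|]; first by exists (u n).
  by case/andP: (hu n).
apply: (@squeeze_cvgr _ _ _ _ (fun=> x) (fun n => x + n.+1%:R^-1)).
- by near=> n; have /andP[/ltW -> /ltW ->] := hu n.
- exact: cvg_cst.
- rewrite -[X in _ --> X]addr0; apply: cvgD; first exact: cvg_cst.
  exact: cvg_harmonic.
Unshelve. all: by end_near. Qed.

(** The form may vary with [n] but is shared by all vectors at a given [n]. The positive diagonal
    entry lets [boundary_gram] leave the cone along the identity matrix. *)
Definition approximable K (v : 'I_K -> 'I_5 -> R) := exists v' : nat -> 'I_K -> 'I_5 -> R,
  [/\ forall n k i, rational (v' n k i),
      forall k i, v' n k i @[n --> \oo] --> v k i &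
      \forall n \near \oo, exists c : 'I_5 -> 'I_5 -> R,
        [/\ symf c, copos c, exists i, 0 < c i i & forall k, zero_of c (v' n k)]].

Lemma qf_scale n (c : 'I_n -> 'I_n -> R) u t : qf c (fun i => t * u i) = t ^+ 2 * qf c u.
Proof.
rewrite /qf /bil mulr_sumr; apply: eq_bigr => i _; rewrite /lin !mulr_sumr.
by apply: eq_bigr => j _; ring.
Qed.

Lemma zero_scale n (c : 'I_n -> 'I_n -> R) u t : 0 <= t -> zero_of c u ->
  zero_of c (fun i => t * u i).
Proof.
move=> t0 [u0 qu]; split=> [i|]; first by rewrite mulr_ge0.
by rewrite qf_scale qu mulr0.
Qed.

Lemma rational_dl n (i p : 'I_n) : rational (dl R i p).
Proof. exact: rational_nat. Qed.

Lemma rational_ez i p : rational (ez R i (i + 1) p).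
Proof.
apply: rationalD; first exact: rational_dl.
by apply: rationalM; [exact: (rational_nat 1)|exact: rational_dl].
Qed.

Lemma horn_zero i x y : 0 <= x -> 0 <= y ->
  zero_of (horn R) (fun p => x * ez R i (i + 1) p + y * ez R (i + 1) (i + 1 + 1) p).
Proof.
have hs : symf (horn R) := @hild_sym R (fun=> 1) (fun=> 0).
have hd j : horn R j j = 1 by exact: hild_diag.
have ze j : zero_of (horn R) (ez R j (j + 1)).
  split=> [p|]; first by rewrite /ez mul1r addr_ge0 // ler0n.
  by rewrite /qf bil_ez !lin_ez [horn R (j + 1) j]hs hd hd horn_next; ring.
move=> x0 y0; split=> [p|].
  by rewrite addr_ge0 // mulr_ge0 // (ze _).1.
rewrite qf_comb // (zero_scale x0 (ze i)).2 (ze (i + 1)).2.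
have -> : bil (horn R) (fun p => x * ez R i (i + 1) p) (ez R (i + 1) (i + 1 + 1)) =
    x * bil (horn R) (ez R i (i + 1)) (ez R (i + 1) (i + 1 + 1)).
  by rewrite /bil mulr_sumr; apply: eq_bigr => p _; rewrite mulrA.
by rewrite bil_ez !lin_ez hd !horn_next horn_next2; ring.
Qed.

(** The form stays fixed here: the edge zeros are rational, and only their coefficients are
    approximated. *)
Lemma horn_approximable K (v : 'I_K -> 'I_5 -> R) :
  (forall k, exists i x y, [/\ 0 <= x, 0 <= y &
     forall p, v k p = x * ez R i (i + 1) p + y * ez R (i + 1) (i + 1 + 1) p]) ->
  approximable v.
Proof.
move=> hv; have /choice[f hf] : forall k, exists f : 'I_5 * R * R,
    [/\ 0 <= f.1.2, 0 <= f.2 & forall p, v k p = f.1.2 * ez R f.1.1 (f.1.1 + 1) p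
      + f.2 * ez R (f.1.1 + 1) (f.1.1 + 1 + 1) p].
  by move=> k; have [i [x [y h]]] := hv k; exists (i, x, y).
have /choice[a ha] := rational_seq.
exists (fun n k p => a (f k).1.2 n * ez R (f k).1.1 ((f k).1.1 + 1) p
  + a (f k).2 n * ez R ((f k).1.1 + 1) ((f k).1.1 + 1 + 1) p); split.
- move=> n k p; apply: rationalD; apply: rationalM; try exact: rational_ez.
    by case: (ha (f k).1.2).
  by case: (ha (f k).2).
- move=> k p; have [_ _ ->] := hf k.
  by apply: cvgD; apply: cvgMr_tmp; [case: (ha (f k).1.2)|case: (ha (f k).2)].
near=> n; exists (horn R); split.
- exact: (@hild_sym R (fun=> 1) (fun=> 0)).
- exact: horn_copos.
- by exists 0; rewrite [horn R 0 0]hild_diag.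
move=> k; have [x0 y0 _] := hf k; apply: horn_zero.
  by have [_ /(_ n) h _] := ha (f k).1.2; rewrite (le_trans x0) // ltW.
by have [_ /(_ n) h _] := ha (f k).2; rewrite (le_trans y0) // ltW.
Unshelve. all: by end_near. Qed.

(** The scaling contains square roots, but any positive scaling preserves copositivity, so rational
    approximations of [d] can be used for vectors and form alike. *)
Lemma rescale_approximable K (v : 'I_K -> 'I_5 -> R) (d : 'I_5 -> R) (s : {perm 'I_5}) :
  (forall i, 0 < d i) -> approximable v ->
  approximable (fun k p => d p * v k (s p)).
Proof.
move=> d0 [v' [rv cv gv]]; have /choice[a ha] := rational_seq.
exists (fun n k p => a (d p) n * v' n k (s p)); split.
- move=> n k p; apply: rationalM => //; by case: (ha (d p)).
- by move=> k p; apply: cvgM => //; case: (ha (d p)).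
near=> n; have [|c [sc cc [i ci] zc]] := near gv n _; first by [].
have a0 p : 0 < a (d p) n by have [_ /(_ n) h _] := ha (d p); rewrite (lt_trans (d0 p)).
have b0 p : 0 < (a (d p) n)^-1 by rewrite invr_gt0.
exists (rescale s (fun p => (a (d p) n)^-1) c); split.
- by move=> p q; rewrite /rescale sc (mulrC (_^-1)).
- exact: copos_rescale.
- exists ((s^-1)%g i); rewrite /rescale permKV; by rewrite !mulr_gt0.
move=> k; have := zero_rescale s b0 (zc k).
suff -> : (fun i => v' n k (s i) / (a (d i) n)^-1) = (fun p => a (d p) n * v' n k (s p)) by [].
by apply/funext => p; rewrite invrK mulrC.
Unshelve. all: by end_near. Qed.
End Rational.

Section HildApprox.
Variable R : realType.

(** Stereographic projection from (-1, 0): the parameter [b / (1 + a)], the tangent of the half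
    angle, is approximated by rationals. *)
Lemma circle_seq (a b : R) : a ^+ 2 + b ^+ 2 = 1 -> 0 < b ->
  exists f : nat -> R * R,
  [/\ forall n, rational (f n).1 /\ rational (f n).2,
      forall n, (f n).1 ^+ 2 + (f n).2 ^+ 2 = 1 /\ 0 < (f n).2,
      (f n).1 @[n --> \oo] --> a & (f n).2 @[n --> \oo] --> b].
Proof.
move=> ab b0; have a1 : 0 < 1 + a.
  have := exprn_gt0 2 b0; rewrite (_ : b ^+ 2 = (1 - a) * (1 + a)); last first.
    by rewrite -[b ^+ 2](addKr (a ^+ 2)) ab; ring.
  by move=> h; rewrite ltNge; apply/negP => a2; move: h; apply/negP; rewrite -leNgt; nra.
have nz : 1 + a != 0 by rewrite gt_eqF.
have [u [ru u0 cu]] := rational_seq (b / (1 + a)).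
have up n : 0 < u n by rewrite (lt_trans _ (u0 n)) // divr_gt0.
have dp n : 0 < 1 + u n ^+ 2 by have := sqr_ge0 (u n); lra.
have r1 : rational (1 : R) by rewrite -[1]mulr1n; exact: rational_nat.
have ru2 n : rational (u n ^+ 2) by exact: rationalM.
have cu2 : u n ^+ 2 @[n --> \oo] --> (b / (1 + a)) ^+ 2 by rewrite expr2; apply: cvgM.
have cd : (1 + u n ^+ 2)^-1 @[n --> \oo] --> (1 + (b / (1 + a)) ^+ 2)^-1.
  apply: cvgV; first by have := sqr_ge0 (b / (1 + a)) => h; rewrite gt_eqF //; lra.
  by apply: cvgD => //; exact: cvg_cst.
have ed : 1 + (b / (1 + a)) ^+ 2 = 2 / (1 + a).
  have -> : (b / (1 + a)) ^+ 2 = (1 - a ^+ 2) / (1 + a) ^+ 2.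
    by rewrite expr_div_n -[b ^+ 2](addKr (a ^+ 2)) ab addrC.
  by field.
exists (fun n => ((1 - u n ^+ 2) / (1 + u n ^+ 2), 2 * u n / (1 + u n ^+ 2))); split=> /=.
- move=> n; have rd : rational (1 + u n ^+ 2)^-1 by apply/rationalV/rationalD.
  split; apply: rationalM => //; first by apply: rationalD => //; apply: rationalN.
  by apply: rationalM => //; exact: (@rational_nat R 2).
- move=> n; split; last by rewrite divr_gt0 // mulr_gt0.
  by field; rewrite gt_eqF.
- have -> : a = (1 - (b / (1 + a)) ^+ 2) * (1 + (b / (1 + a)) ^+ 2)^-1.
    rewrite ed expr_div_n -[b ^+ 2](addKr (a ^+ 2)) ab addrC; field.
    by rewrite nz.
  apply: cvgM => //; apply: cvgB => //; exact: cvg_cst.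
have -> : b = 2 * (b / (1 + a)) * (1 + (b / (1 + a)) ^+ 2)^-1.
  by rewrite ed; field.
by apply: cvgM => //; apply: cvgMl_tmp.
Qed.

Section Cvg.
Variables (con sin : nat -> 'I_5 -> R) (co si : 'I_5 -> R).
Hypothesis cco : forall i, con n i @[n --> \oo] --> co i.
Hypothesis csi : forall i, sin n i @[n --> \oo] --> si i.

Lemma cvg_hild i j : hild (con n) (sin n) i j @[n --> \oo] --> hild co si i j.
Proof.
have h k : con n k * con n (k + 1) - sin n k * sin n (k + 1) @[n --> \oo]
    --> co k * co (k + 1) - si k * si (k + 1).
  by apply: cvgB; apply: cvgM.
rewrite /hild; case: ifP => _; first exact: cvg_cst.
case: ifP => _; first exact: cvgN.
case: ifP => _; first exact: cvgN.
by case: ifP.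
Qed.

Lemma cvg_hild_mid (i : 'I_5) :
  sin n i * con n (i + 1) + con n i * sin n (i + 1) @[n --> \oo]
  --> si i * co (i + 1) + co i * si (i + 1).
Proof. by apply: cvgD; apply: cvgM. Qed.

Lemma cvg_hild_zero i p :
  hild_zero (con n) (sin n) i p @[n --> \oo] --> hild_zero co si i p.
Proof.
rewrite /hild_zero; case: ifP => _ //; case: ifP => _; first exact: cvg_hild_mid.
by case: ifP => _ //; exact: cvg_cst.
Qed.

Lemma cvg_hild_lin i p :
  lin (hild (con n) (sin n)) (hild_zero (con n) (sin n) i) p @[n --> \oo]
  --> lin (hild co si) (hild_zero co si i) p.
Proof.
rewrite lin_cell; under eq_fun do rewrite lin_cell.
apply: cvgD; last by apply: cvgM => //; exact: cvg_hild.
apply: cvgD; apply: cvgM => //; try exact: cvg_hild.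
exact: cvg_hild_mid.
Qed.
End Cvg.

(** The sines are positive for all [n]; the middle entries and the values off the cells converge to
    positive limits, hence are positive eventually, and [hild_cyclic] applies. *)
Lemma hild_approximable K (v : 'I_K -> 'I_5 -> R) (co si : 'I_5 -> R) :
  (forall i, co i ^+ 2 + si i ^+ 2 = 1) -> (forall i, 0 < si i) ->
  (forall i : 'I_5, 0 < si i * co (i + 1) + co i * si (i + 1)) ->
  (forall i p, p \notin cell i -> 0 < lin (hild co si) (hild_zero co si i) p) ->
  (forall k, exists i t, 0 <= t /\ forall p, v k p = t * hild_zero co si i p) ->
  approximable v.
Proof.
move=> cs s0 m0 l0 hv.
have /choice[f hf] : forall k, exists f : 'I_5 * R,
    0 <= f.2 /\ forall p, v k p = f.2 * hild_zero co si f.1 p.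
  by move=> k; have [i [t h]] := hv k; exists (i, t).
have /choice[a ha] := @rational_seq R.
have /choice[g hg] : forall i, exists f : nat -> R * R,
  [/\ forall n, rational (f n).1 /\ rational (f n).2,
      forall n, (f n).1 ^+ 2 + (f n).2 ^+ 2 = 1 /\ 0 < (f n).2,
      (f n).1 @[n --> \oo] --> co i & (f n).2 @[n --> \oo] --> si i].
  by move=> i; exact: circle_seq.
pose con n i := (g i n).1; pose sin n i := (g i n).2.
have cco i : con n i @[n --> \oo] --> co i by case: (hg i).
have csi i : sin n i @[n --> \oo] --> si i by case: (hg i).
have rc n i : rational (con n i) by case: (hg i) => /(_ n) [].
have rs n i : rational (sin n i) by case: (hg i) => /(_ n) [].
exists (fun n k p => a (f k).2 n * hild_zero (con n) (sin n) (f k).1 p); split.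
- move=> n k p; apply: rationalM; first by case: (ha (f k).2).
  rewrite /hild_zero; case: ifP => _ //; case: ifP => _.
    by apply: rationalD; apply: rationalM.
  by case: ifP => _ //; exact: rational_nat 0.
- move=> k p; rewrite (hf k).2; apply: cvgM; first by case: (ha (f k).2).
  exact: cvg_hild_zero.
have nm : \forall n \near \oo, forall i, 0 < sin n i * con n (i + 1) + con n i * sin n (i + 1).
  apply: filter_forall => i.
  by apply: cvgr_gt (m0 i); exact: cvg_hild_mid.
have nl : \forall n \near \oo, forall i p, p \notin cell i ->
    0 <= lin (hild (con n) (sin n)) (hild_zero (con n) (sin n) i) p.
  apply: filter_forall => i; apply: filter_forall => p.
  case: (boolP (p \notin cell i)) => [pi|_]; last by near=> n.
  near=> n; move=> _; apply: ltW; near: n.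
  by apply: cvgr_gt (l0 i p pi); exact: cvg_hild_lin.
near=> n; exists (hild (con n) (sin n)).
have [cop zer] : copos (hild (con n) (sin n)) /\
    forall i, zero_of (hild (con n) (sin n)) (hild_zero (con n) (sin n) i).
  apply: hild_cyclic.
  - by move=> i; case: (hg i) => _ /(_ n) [].
  - by move=> i; case: (hg i) => _ /(_ n) [].
  - by near: n.
  - by near: n.
split=> //.
- exact: hild_sym.
- by exists 0; rewrite hild_diag.
move=> k; apply: zero_scale => //; have [_ /(_ n) h _] := ha (f k).2.
by rewrite (le_trans (hf k).1) // ltW.
Unshelve. all: by end_near. Qed.

Lemma exposing_approximable K (v : 'I_K -> 'I_5 -> R) (c : 'I_5 -> 'I_5 -> R) :
  exposing c -> (forall k, zero_of c (v k)) -> approximable v.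
Proof.
(* This scaling makes the diagonal 1; the relabelling [s] then puts the generators in cyclic order,
   and both are undone by [rescale_approximable]. *)
move=> ec zv; pose d i := (Num.sqrt (c i i))^-1.
have d0 i : 0 < d i by rewrite invr_gt0 sqrtr_gt0 exposing_diag_gt0.
have dd i : d i * d i * c i i = 1.
  have c0 := exposing_diag_gt0 ec i.
  rewrite -expr2 exprVn sqr_sqrtr ?ltW // mulVf // gt_eqF //.
have c01 i : rescale 1%g d c i i = 1 by rewrite /rescale !perm1 dd.
have [s hs] := exposing_cyclic (exposing_rescale 1%g d0 ec) c01.
pose ds i := d (s i); have ds0 i : 0 < ds i by exact: d0.
pose c' := rescale s ds c.
have ec' : exposing c' by exact: exposing_rescale.
have c'E i j : c' i j = rescale 1%g d c (s i) (s j) by rewrite /rescale !perm1.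
have c1 i : c' i i = 1 by rewrite c'E c01.
suff : approximable (fun k i => v k (s i) / ds i).
  move/(rescale_approximable (s^-1)%g d0).
  congr (approximable _); apply/funext => k; apply/funext => p.
  by rewrite /ds permKV mulrC divfK // gt_eqF.
have zv' k : zero_of c' (fun i => v k (s i) / ds i) by exact: zero_rescale.
case: hs => [he|ht].
  apply: horn_approximable => k; apply: (horn_zero_shape ec' c1) => // i.
  by rewrite c'E he.
have ht' i : exists u, tight c' i (i + 1) (i + 1 + 1) u.
  have [u [zu up ne]] := ht i; exists (fun p => u (s p)); split.
  - have := zero_rescale s (fun _ => ltr01) zu.
    suff -> : rescale s (fun=> 1) (rescale 1%g d c) = c'.
      suff -> : (fun p => u (s p) / 1) = (fun p => u (s p)) by [].
      by apply/funext => p; rewrite divr1.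
    by apply/funext => p; apply/funext => q; rewrite c'E [LHS]/rescale !mul1r.
  - by move=> p; rewrite up !inE !(inj_eq perm_inj).
  - move=> p q hp hq; rewrite c'E; apply: ne.
      by move: hp; rewrite !inE !(inj_eq perm_inj).
    by move: hq; rewrite !inE !(inj_eq perm_inj).
have [co [si [cs s0 m0 cE hz]]] := cyclic_hild ec' c1 ht'.
have eE : c' = hild co si by apply/funext => i; apply/funext => j.
apply: (hild_approximable cs s0 m0) => [i p|k]; last exact: hz.
have n34 : i + 1 + 1 + 1 != i + 1 + 1 + 1 + 1 by case_ord5 i.
move=> pi; have [h0 h1 h2 h3] := hild_zeroE co si i.
have e2 : exposing (hild co si) by rewrite -eE.
have zi : zero_of (hild co si) (hild_zero co si i).
  split=> [q|].
    case: (boolP (q \in cell i)) => [|/h3->//].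
    by rewrite !inE => /or3P[] /eqP->; rewrite ?h0 ?h1 ?h2 ltW.
  rewrite /qf /bil big1 // => q _; case: (boolP (q \in cell i)) => [/(hild_lin0 cs)->|/h3->].
    by rewrite mulr0.
  by rewrite mul0r.
have gt q : q \in cell i -> 0 < hild_zero co si i q.
  by rewrite !inE => /or3P[] /eqP->; rewrite ?h0 ?h1 ?h2.
(* Strictness off the cell comes from [exposing_lin_gt0], the zero being positive at all indices but
   two. *)
have := pi; rewrite mem_cell -negb_or negbK => /orP[] /eqP->.
  apply: (exposing_lin_gt0 e2 (m := i + 1 + 1 + 1 + 1) zi) => // q q1 q2.
  by apply: gt; rewrite mem_cell q1 q2.
apply: (exposing_lin_gt0 e2 (m := i + 1 + 1 + 1) zi) => [|q q1 q2]; first by rewrite eq_sym.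
by apply: gt; rewrite mem_cell q2 q1.
Qed.
End HildApprox.

(** * Supporting forms of the completely positive cone *)

Section CPcone.
Variables (R : realType) (n : nat).
Implicit Types (M X P : 'M[R]_n).

Lemma gramE k (B : 'M[R]_(n, k)) i j : (B *m B^T) i j = \sum_p B i p * B j p.
Proof. by rewrite mxE; apply: eq_bigr => p _; rewrite mxE. Qed.

Lemma CP_add X Y : CP X -> CP Y -> CP (X + Y).
Proof.
move=> [k [B [B0 ->]]] [l [D [D0 ->]]]; exists (k + l)%N, (row_mx B D); split.
  by move=> i j; rewrite mxE; case: split.
by rewrite tr_row_mx mul_row_col.
Qed.

Lemma CP_scale (t : R) X : 0 <= t -> CP X -> CP (t *: X).
Proof.
move=> t0 [k [B [B0 ->]]]; exists k, (Num.sqrt t *: B); split.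
  by move=> i j; rewrite mxE mulr_ge0 // sqrtr_ge0.
by rewrite linearZ /= -scalemxAl -scalemxAr scalerA -expr2 sqr_sqrtr.
Qed.

Lemma CP_rank1 (x : 'I_n -> R) : (forall i, 0 <= x i) -> CP (\matrix_(i, j) (x i * x j)).
Proof.
move=> x0; exists 1%N, (\matrix_(i, j) x i); split=> [i j|]; first by rewrite mxE.
by apply/matrixP => i j; rewrite gramE big_ord1 !mxE.
Qed.

Lemma CP_sym X : CP X -> Defs.is_sym X.
Proof. by move=> [k [B [_ ->]]]; rewrite /Defs.is_sym trmx_mul trmxK. Qed.

(** More than n^2 rank-one matrices satisfy a linear relation [mu]. The weights [1 - mu p / mu q],
    with [mu q] maximal and positive, are nonnegative, keep the sum and vanish at [q], whose column
    is dropped. *)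
Lemma caratheodory_step k (B : 'M[R]_(n, k.+1)) : (n * n < k.+1)%N ->
  (forall i j, 0 <= B i j) ->
  exists B' : 'M[R]_(n, k), (forall i j, 0 <= B' i j) /\ B' *m B'^T = B *m B^T.
Proof.
move=> lt B0; pose Z : 'M[R]_(k.+1, n * n) := \matrix_p mxvec (\matrix_(i, j) (B i p * B j p)).
have : kermx Z != 0.
  by rewrite -mxrank_eq0 mxrank_ker -lt0n subn_gt0 (leq_ltn_trans (rank_leq_col Z)).
move/rowV0Pn => [mu0 /sub_kermxP muZ mu_neq0].
have [mu [mZ [p0 mup0]]] : exists mu : 'rV[R]_k.+1, mu *m Z = 0 /\ exists p, 0 < mu 0 p.
  have [p mp] : exists p, mu0 0 p != 0.
    apply/existsP; apply: contraNT mu_neq0; rewrite negb_exists => /forallP h.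
    by apply/eqP/rowP => p; rewrite mxE; apply/eqP; have := h p; rewrite negbK.
  have [lt0|gt0|e] := ltgtP (mu0 0 p) 0; last by rewrite e eqxx in mp.
    by exists (- mu0); rewrite mulNmx muZ oppr0; split=> //; exists p; rewrite mxE oppr_gt0.
  by exists mu0; split=> //; exists p.
have rel i j : \sum_p mu 0 p * (B i p * B j p) = 0.
  have := congr1 (fun v : 'rV_(n * n) => v 0 (mxvec_index i j)) mZ.
  rewrite !mxE => e; rewrite -[RHS]e; apply: eq_bigr => p _.
  by rewrite !mxE mxvecE mxE.
pose q := [arg max_(q > p0) mu 0 q]%O.
have qmax p : mu 0 p <= mu 0 q.
  by rewrite /q; case: arg_maxP => // r _ h; exact: h.
have q0 : 0 < mu 0 q := lt_le_trans mup0 (qmax p0).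
pose w p := 1 - mu 0 p / mu 0 q.
have w0 p : 0 <= w p by rewrite subr_ge0 ler_pdivrMr // mul1r.
have wq : w q = 0 by rewrite /w divff ?subrr // gt_eqF.
exists (\matrix_(i, p) (Num.sqrt (w (lift q p)) * B i (lift q p))); split.
  by move=> i p; rewrite mxE mulr_ge0 // sqrtr_ge0.
apply/matrixP => i j; rewrite !gramE.
transitivity (\sum_p w p * (B i p * B j p)).
  rewrite [RHS](bigD1_ord q) //= wq mul0r add0r; apply: eq_bigr => p _.
  by rewrite !mxE mulrACA -expr2 sqr_sqrtr.
under eq_bigr => p _.
  rewrite /w mulrBl mul1r [mu 0 p / _]mulrC -mulrA.
  over.
by rewrite sumrB -mulr_sumr rel mulr0 subr0.
Qed.

Lemma caratheodory X : CP X -> exists B : 'M[R]_(n, n * n),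
  (forall i j, 0 <= B i j) /\ X = B *m B^T.
Proof.
move=> [k [B [B0 ->]]]; have [le|lt] := leqP k (n * n).
  rewrite -(subnKC le); exists (row_mx B 0); split.
    by move=> i j; rewrite mxE; case: split => // a; rewrite mxE.
  by rewrite tr_row_mx mul_row_col mul0mx addr0.
have [m ek] : exists m, k = (n * n + m)%N by exists (k - n * n)%N; rewrite subnKC // ltnW.
subst k; elim: m B B0 {lt} => [|m IH] B B0.
  by move: B B0; rewrite addn0 => B B0; exists B.
move: B B0; rewrite addnS => B B0.
have [|B' [B'0 <-]] := caratheodory_step _ B0; first by rewrite ltnS leq_addr.
exact: IH.
Qed.

Definition frob M X : R := \sum_i \sum_j M i j * X i j.

Lemma frobC M X : frob M X = frob X M.
Proof. by apply: eq_bigr => i _; apply: eq_bigr => j _; rewrite mulrC. Qed.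

Lemma frobDl M X P : frob (M + X) P = frob M P + frob X P.
Proof.
rewrite -big_split; apply: eq_bigr => i _; rewrite -big_split.
by apply: eq_bigr => j _; rewrite mxE mulrDl.
Qed.

Lemma frobZl t M P : frob (t *: M) P = t * frob M P.
Proof.
rewrite mulr_sumr; apply: eq_bigr => i _; rewrite mulr_sumr.
by apply: eq_bigr => j _; rewrite mxE mulrA.
Qed.

Lemma frob_ge0 M : 0 <= frob M M.
Proof. by apply: sumr_ge0 => i _; apply: sumr_ge0 => j _; rewrite -expr2 sqr_ge0. Qed.

Lemma frob_entry M i j : M i j ^+ 2 <= frob M M.
Proof.
rewrite /frob (bigD1 i) //= (bigD1 j) //= -expr2 -addrA lerDl addr_ge0 //.
  by apply: sumr_ge0 => q _; rewrite -expr2 sqr_ge0.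
by apply: sumr_ge0 => p _; apply: sumr_ge0 => q _; rewrite -expr2 sqr_ge0.
Qed.

Lemma continuous_sum (T : topologicalType) I (r : seq I) (F : I -> T -> R) :
  (forall i, continuous (F i)) -> continuous (fun x => \sum_(i <- r) F i x).
Proof.
move=> cF; elim: r => [|i r IH] x.
  by under eq_fun do rewrite big_nil; exact: cvg_cst.
by under eq_fun do rewrite big_cons; rewrite ?big_cons; apply: cvgD; [exact: cF|exact: IH].
Qed.

Lemma continuous_mul (T : topologicalType) (f g : T -> R) :
  continuous f -> continuous g -> continuous (fun x => f x * g x).
Proof. by move=> cf cg x; apply: cvgM; [exact: cf|exact: cg]. Qed.

(** Carathéodory's bound puts all factors in one finite-dimensional space, where a compact box
    suffices. Closedness of the cone is a consequence, see [CP_closed]. *)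
Lemma CP_nearest M : exists P, CP P /\ forall X, CP X ->
  frob (M - P) (M - P) <= frob (M - X) (M - X).
Proof.
pose N := (n * n)%N; pose G (y : 'rV[R]_(n * N)) : 'M[R]_n := vec_mx y *m (vec_mx y)^T.
(* A factor with an entry above [r] has a diagonal entry of its product at least r^2, which makes
   that product at least as far from [M] as 0 is. *)
pose r := 2 * (1 + frob M M).
have F0 := frob_ge0 M.
have r0 : 0 <= r by rewrite mulr_ge0 //; lra.
pose K := [set y : 'rV[R]_(n * N) | forall i, [set` `[0, r]] (y ord0 i)].
have cK : compact K by apply: (@rV_compact _ _ (fun=> [set` `[0, r]])) => i; exact: segment_compact.
have K0 : K !=set0.
  by exists 0 => i /=; rewrite mxE in_itv /= lexx.
pose f y := frob (M - G y) (M - G y).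
have cf : continuous f.
  apply: continuous_sum => i; apply: continuous_sum => j.
  have h : continuous (fun y => (M - G y) i j).
    have -> : (fun y => (M - G y) i j) =
        (fun y => M i j - \sum_p y 0 (mxvec_index i p) * y 0 (mxvec_index j p)).
      by apply/funext => y; rewrite !mxE; congr (_ - _); apply: eq_bigr => p _; rewrite !mxE.
    have hS : continuous (fun y : 'rV[R]_(n * N) =>
        \sum_p y 0 (mxvec_index i p) * y 0 (mxvec_index j p)).
      apply: (@continuous_sum _ _ _ (fun p (y : 'rV[R]_(n * N)) =>
        y 0 (mxvec_index i p) * y 0 (mxvec_index j p))) => p.
      by apply: continuous_mul; exact: coord_continuous.
    by move=> y; exact: (cvgB (cvg_cst (M i j)) (hS y)).
  exact: continuous_mul.
have [y yK ymin] := EVT_min_rV K0 cK (continuous_subspaceT cf).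
have pos z : K z -> forall i p, 0 <= vec_mx z i p :> R.
  by move=> zK i p; rewrite mxE; have := zK (mxvec_index i p); rewrite /= in_itv => /andP[].
rewrite inE in yK.
exists (G y); split; first by exists N, (vec_mx y); split=> //; exact: pos.
move=> X /caratheodory[B [B0 eX]].
have [BK|BK] := pselect (K (mxvec B)).
  have -> : X = G (mxvec B) by rewrite /G mxvecK.
  by apply: ymin; rewrite inE.
have [p [q Bpq]] : exists p q, r < B p q.
  apply: contrapT => h; apply: BK => i; rewrite /= in_itv /=.
  case/mxvec_indexP: i => p q; rewrite mxvecE B0 /= leNgt; apply/negP => lt.
  by apply: h; exists p, q.
apply: (@le_trans _ _ (f 0)).
  by apply: ymin; rewrite inE => i /=; rewrite mxE in_itv /= lexx.
have -> : f 0 = frob M M by rewrite /f /G linear0 mul0mx subr0.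
apply: le_trans (frob_entry (M - X) p p); rewrite mxE [(- X) p p]mxE.
have Xpp : r ^+ 2 <= X p p.
  rewrite eX gramE (bigD1 q) //= -expr2 ler_wpDr //.
    by apply: sumr_ge0 => k _; rewrite -expr2 sqr_ge0.
  by rewrite ler_pXn2r ?nnegrE // ltW.
have Mpp : M p p ^+ 2 <= frob M M := frob_entry M p p.
move: F0 Xpp Mpp; rewrite /r; move: (frob M M) (X p p) (M p p) => F x m F0 Xpp Mpp.
have m1 : m <= 1 + F by nra.
have h1 : 1 + F <= x - m by nra.
have h2 : (1 + F) ^+ 2 <= (x - m) ^+ 2 by rewrite ler_pXn2r ?nnegrE //; lra.
rewrite (_ : (m - x) ^+ 2 = (x - m) ^+ 2); last by ring.
by apply: le_trans h2; nra.
Qed.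
End CPcone.

Section Separation.
Variables (R : realType) (n : nat).
Implicit Types (M X P C : 'M[R]_n).

Lemma frob_sub M X : frob (M - X) (M - X) = frob M M - 2 * frob M X + frob X X.
Proof.
have e Y : frob (M - X) Y = frob M Y - frob X Y.
  by rewrite frobDl -scaleN1r frobZl mulN1r.
rewrite e (frobC M) (frobC X) !e (frobC X M); ring.
Qed.

Lemma frob_near M X e : near_mx M X e -> frob (M - X) (M - X) <= (n * n)%:R * e ^+ 2.
Proof.
move=> h; apply: (@le_trans _ _ (\sum_(i < n) \sum_(j < n) e ^+ 2)).
  apply: ler_sum => i _; apply: ler_sum => j _; rewrite -expr2 !mxE.
  have e0 : 0 <= e := le_trans (normr_ge0 _) (ltW (h i j)).
  by rewrite -real_normK ?num_real // ler_pXn2r ?nnegrE // ltW.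
by rewrite !sumr_const !card_ord -mulrnA mulr_natl.
Qed.

Lemma frob_eq0 M : frob M M <= 0 -> M = 0.
Proof.
move=> h; apply/matrixP => i j; rewrite mxE; apply/eqP; rewrite -sqrf_eq0 eq_le sqr_ge0 andbT.
exact: le_trans (frob_entry M i j) h.
Qed.

Lemma le0_lim (a b : R) : 0 <= b -> (forall e, 0 < e -> a <= b * e) -> a <= 0.
Proof.
move=> b0 h; rewrite leNgt; apply/negP => a0.
have d0 : 0 < 2 * (b + 1) by lra.
have := h (a / (2 * (b + 1))) (divr_gt0 a0 d0).
rewrite mulrA ler_pdivlMr //; nra.
Qed.

Lemma CP_closed M : sym_closure (@CP R n) M -> CP M.
Proof.
move=> [_ cM]; have [P [cP hP]] := CP_nearest M.
suff : M - P = 0 by move/subr0_eq->.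
apply/frob_eq0/(@le0_lim _ (n * n)%:R) => // e e0.
(* The bound is quadratic in the radius, and [e ^+ 2 <= e] holds only up to 1; for larger [e] the
   radius 1 is used. *)
have [e1|e1] := leP 1 e.
  have [X [_ [nX cX]]] := cM 1 ltr01.
  apply: le_trans (hP X cX) _; apply: le_trans (frob_near nX) _.
  by rewrite expr1n ler_wpM2l.
have [X [_ [nX cX]]] := cM e e0.
apply: le_trans (hP X cX) _; apply: le_trans (frob_near nX) _.
by rewrite ler_wpM2l // expr2 ler_piMr // ltW.
Qed.

Definition coform C : 'I_n -> 'I_n -> R := fun i j => C i j.

Lemma qf_frob C (x : 'I_n -> R) : qf (coform C) x = frob C (\matrix_(i, j) (x i * x j)).
Proof.
apply: eq_bigr => i _; rewrite mulr_sumr; apply: eq_bigr => j _.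
by rewrite mxE /coform; ring.
Qed.

(** The form is [P - M], normalized, for [P] nearest to [M]. Minimality along [P + t X] gives
    copositivity, and along [(1 - t) P] it gives [frob D P <= 0], hence the sign at [M]. *)
Lemma CP_separation M : Defs.is_sym M -> ~ CP M -> exists C,
  [/\ Defs.is_sym C, frob C C = 1, copos (coform C) & frob C M <= 0].
Proof.
move=> sM nM; have [P [cP hP]] := CP_nearest M.
pose D := P - M.
have D0 : 0 < frob D D.
  rewrite lt_def frob_ge0 andbT; apply/eqP => h; apply: nM.
  by have /subr0_eq <- : P - M = 0 by apply: frob_eq0; rewrite -/D h.
have DX X : CP X -> 0 <= frob D X.
  move=> cX; apply: (@quad_pos_ge0 _ (frob X X)) => t t0 _.
  have := hP (P + t *: X) (CP_add cP (CP_scale (ltW t0) cX)).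
  have -> : M - (P + t *: X) = (M - P) - t *: X by rewrite opprD addrA.
  rewrite (frob_sub (M - P)).
  have -> : M - P = (-1) *: D by rewrite scaleN1r opprB.
  rewrite !frobZl !(frobC _ (_ *: _)) !frobZl (frobC X D); lra.
have DP : frob D P <= 0.
  rewrite -oppr_ge0; apply: (@quad_pos_ge0 _ (frob P P)) => t t0 t1.
  have := hP ((1 - t) *: P) (CP_scale _ cP); rewrite subr_ge0 => /(_ t1).
  have -> : M - (1 - t) *: P = (M - P) - (- t) *: P.
    by rewrite scalerBl scale1r scaleNr opprB opprK addrA [M + _ - _]addrAC.
  rewrite (frob_sub (M - P)).
  have -> : M - P = (-1) *: D by rewrite scaleN1r opprB.
  rewrite !frobZl !(frobC _ (_ *: _)) !frobZl (frobC P D); lra.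
pose a := (Num.sqrt (frob D D))^-1.
have a0 : 0 <= a by rewrite invr_ge0 sqrtr_ge0.
have aa : a * a * frob D D = 1.
  by rewrite -expr2 exprVn sqr_sqrtr ?ltW // mulVf // gt_eqF.
exists (a *: D); split.
- rewrite /Defs.is_sym linearZ /= /D linearB /=.
  by rewrite sM (CP_sym cP).
- by rewrite frobZl frobC frobZl mulrA.
- by move=> x x0; rewrite qf_frob frobZl mulr_ge0 // DX //; exact: CP_rank1.
rewrite frobZl mulr_ge0_le0 //.
have -> : M = P - D by rewrite /D opprB addrC subrK.
by rewrite frobC frobDl -scaleN1r frobZl frobC; lra.
Qed.

Lemma frob_le_near C M X e : frob C C = 1 -> near_mx M X e ->
  frob C (M - X) <= (n * n)%:R * e.
Proof.
move=> c1 h; rewrite natrM mulrAC.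
have -> : n%:R * e * n%:R = \sum_(i < n) \sum_(j < n) e.
  by rewrite !sumr_const !card_ord -mulrnA -[in RHS]mulr_natl natrM; ring.
apply: ler_sum => i _; apply: ler_sum => j _.
have := frob_entry C i j; rewrite c1 => cij.
have {}cij : `|C i j| <= 1 by rewrite -(@expr_le1 _ 2) // real_normK ?num_real.
apply: le_trans (ler_norm _) _; rewrite normrM !mxE.
by apply: le_trans (ler_piMl _ cij) _ => //; exact: ltW (h i j).
Qed.

(* A supporting hyperplane, obtained as a minimizer of [frob _ M] over the
   compact set of normalized copositive matrices. *)
Lemma CP_support M : sym_closure (fun B : 'M[R]_n => ~ CP B) M ->
  exists C, [/\ Defs.is_sym C, frob C C = 1, copos (coform C) & frob C M <= 0].
Proof.
move=> [sM cM].
pose J := [set` `[(-1 : R), 1]].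
pose Q := [set y : 'rV[R]_(n * n) | forall i, J (y ord0 i)].
pose V (y : 'rV[R]_(n * n)) : 'M[R]_n := vec_mx y.
have cV i j : continuous (fun y => V y i j).
  have -> : (fun y => V y i j) = (fun y => y 0 (mxvec_index i j)).
    by apply/funext => y; rewrite /V mxE.
  exact: coord_continuous.
have cF (W : 'rV[R]_(n * n) -> 'M[R]_n) : (forall i j, continuous (fun y => W y i j)) ->
    continuous (fun y => frob (V y) (W y)).
  move=> cW; apply: continuous_sum => i; apply: continuous_sum => j.
  exact: continuous_mul.
have ccst M' : continuous (fun y => frob (V y) M').
  by apply: (cF (fun=> M')) => i j; exact: cst_continuous.
pose S1 := [set y | frob (V y) (V y) = 1].
pose S2 := \bigcap_(ij in [set: 'I_n * 'I_n])
  [set y | frob (V y) (delta_mx ij.1 ij.2 - delta_mx ij.2 ij.1) = 0].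
pose S3 := \bigcap_(x in [set x : 'I_n -> R | forall i, 0 <= x i])
  [set y | 0 <= frob (V y) (\matrix_(i, j) (x i * x j))].
have clS1 : closed S1.
  by have /continuous_closedP/(_ _ (@closed_eq R 1)) := cF V cV.
have clS2 : closed S2.
  apply: closed_bigI => ij _.
  by have /continuous_closedP/(_ _ (@closed_eq R 0)) := ccst (delta_mx ij.1 ij.2 - delta_mx ij.2 ij.1).
have clS3 : closed S3.
  apply: closed_bigI => x _.
  by have /continuous_closedP/(_ _ (@closed_ge R 0)) := ccst (\matrix_(i, j) (x i * x j)).
have cK : compact (Q `&` (S1 `&` (S2 `&` S3))).
  apply: compact_closedI; last by apply: closedI => //; exact: closedI.
  by apply: (@rV_compact _ _ (fun=> J)) => i; exact: segment_compact.
have frob_delta C i j : frob C (delta_mx i j) = C i j.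
  rewrite /frob (bigD1 i) //= (bigD1 j) //= mxE !eqxx mulr1 !big1 ?addr0 //.
    by move=> p pi; rewrite big1 // => q _; rewrite mxE (negPf pi) mulr0.
  by move=> q qj; rewrite mxE (negPf qj) andbF mulr0.
have frobBr C X Y : frob C (X - Y) = frob C X - frob C Y.
  by rewrite frobC frobDl -scaleN1r frobZl mulN1r !(frobC _ C).
have memK C : Defs.is_sym C -> frob C C = 1 -> copos (coform C) ->
    (Q `&` (S1 `&` (S2 `&` S3))) (mxvec C).
  move=> sC C1 cC; split; last split; last split.
  - move=> i; case/mxvec_indexP: i => i j; rewrite mxvecE /J /= in_itv /= -ler_norml.
    by rewrite -(@expr_le1 _ 2) // real_normK ?num_real // -C1 frob_entry.
  - by rewrite /S1 /= /V mxvecK.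
  - move=> [i j] _ /=; rewrite /V mxvecK frobBr !frob_delta.
    by rewrite -{2}sC mxE subrr.
  - by move=> x x0 /=; rewrite /V mxvecK -qf_frob; exact: cC.
have Kmem y : (Q `&` (S1 `&` (S2 `&` S3))) y ->
    [/\ Defs.is_sym (V y), frob (V y) (V y) = 1 & copos (coform (V y))].
  move=> [_ [h1 [h2 h3]]]; split=> //.
    apply/matrixP => i j; rewrite mxE; have := h2 (i, j) Logic.I.
    by rewrite /= frobBr !frob_delta => /subr0_eq.
  by move=> x x0; rewrite qf_frob; exact: (h3 x).
(* Separating a nearby matrix outside the cone gives a normalized form whose value at [M] is
   controlled by the distance; the minimum over the compact set is then at most 0. *)
have approx e : 0 < e -> exists C, [/\ Defs.is_sym C, frob C C = 1, copos (coform C) &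
    frob C M <= (n * n)%:R * e].
  move=> e0; have [X [sX [nX cX]]] := cM e e0.
  have [C [sC C1 cC CX]] := CP_separation sX cX; exists C; split=> //.
  have := frob_le_near C1 nX; rewrite frobBr; lra.
have K0 : (Q `&` (S1 `&` (S2 `&` S3))) !=set0.
  by have [C [sC C1 cC _]] := approx 1 ltr01; exists (mxvec C); exact: memK.
have [y yK ymin] := EVT_min_rV K0 cK (continuous_subspaceT (ccst M)).
rewrite inE in yK; have [sy y1 cy] := Kmem y yK.
exists (V y); split=> //; apply: (@le0_lim _ (n * n)%:R) => // e e0.
have [C [sC C1 cC CM]] := approx e e0; apply: le_trans CM.
have := ymin (mxvec C); rewrite inE => /(_ (memK C sC C1 cC)).
by rewrite /V mxvecK.
Qed.
End Separation.

(** * Density *)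

Section Boundary.
Variables (R : realType) (n : nat).

Lemma sum_gram (c : 'I_n -> 'I_n -> R) k (B : 'M[R]_(n, k)) :
  \sum_i \sum_j c i j * (B *m B^T) i j = \sum_p qf c (B^~ p).
Proof.
transitivity (\sum_i \sum_p B i p * lin c (B^~ p) i); last by rewrite exchange_big.
apply: eq_bigr => i _.
transitivity (\sum_j \sum_p c i j * (B i p * B j p)).
  by apply: eq_bigr => j _; rewrite gramE mulr_sumr.
rewrite exchange_big; apply: eq_bigr => p _; rewrite /lin mulr_sumr.
by apply: eq_bigr => j _; ring.
Qed.

Lemma boundary_gram (c : 'I_n -> 'I_n -> R) k (B : 'M[R]_(n, k)) :
  copos c -> (exists i, 0 < c i i) -> (forall p, zero_of c (B^~ p)) ->
  sym_boundary (@CP R n) (B *m B^T).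
Proof.
move=> cc [i0 ci0] zB; have cpB : CP (B *m B^T).
  by exists k, B; split=> // i p; exact: (zB p).1.
have sB := CP_sym cpB; split; split=> // e e0.
  by exists (B *m B^T); split=> //; split=> // i j; rewrite subrr normr0.
(* Pairing this matrix with [c] gives [- e / 2] times the trace of [c], which is negative, whereas
   completely positive matrices pair nonnegatively with a copositive form. *)
exists (B *m B^T - (e / 2)%:M); split; last split.
- by rewrite /Defs.is_sym linearB /= sB tr_scalar_mx.
- move=> i j; rewrite !mxE opprB addrC subrK.
  by rewrite (le_lt_trans (y := e / 2)) // ?ltr_pdivrMr //;
    case: (i == j); rewrite ?mulr1n ?mulr0n ?normr0 ?ger0_norm; lra.
move=> [l [D [D0 eD]]].
have cd i : 0 <= c i i.
  have := cc (dl R i); rewrite /qf bil_dl lin_dl; apply => j; exact: ler0n.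
have : 0 <= \sum_i \sum_j c i j * (D *m D^T) i j.
  by rewrite sum_gram sumr_ge0 // => p _; apply: cc.
rewrite -eD.
have -> : \sum_i \sum_j c i j * (B *m B^T - (e / 2)%:M) i j =
    \sum_i \sum_j c i j * (B *m B^T) i j - (e / 2) * \sum_i c i i.
  rewrite mulr_sumr -sumrB; apply: eq_bigr => i _.
  rewrite [in RHS](_ : e / 2 * c i i = \sum_j c i j * (e / 2)%:M i j).
    by rewrite -sumrB; apply: eq_bigr => j _; rewrite !mxE mulrBr.
  rewrite (bigD1 i) //= mxE eqxx mulr1n big1 ?addr0 1?mulrC // => j ji.
  by rewrite mxE eq_sym (negPf ji) mulr0n mulr0.
rewrite sum_gram big1 ?sub0r ?oppr_ge0 => [|p _]; last exact: (zB p).2.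
rewrite leNgt mulr_gt0 ?divr_gt0 //.
by rewrite (bigD1 i0) //= ltr_wpDr // sumr_ge0.
Qed.

Lemma interior_near (S : 'M[R]_n -> Prop) A : sym_interior S A ->
  exists2 e, 0 < e & forall X, Defs.is_sym X -> near_mx A X e -> sym_interior S X.
Proof.
move=> [sA [e [e0 h]]]; exists (e / 2); first by rewrite divr_gt0.
move=> X sX nX; split=> //; exists (e / 2); split; first by rewrite divr_gt0.
move=> Y sY nY; apply: h => // i j; rewrite -(subrKA (X i j)).
by apply: le_lt_trans (ler_normD _ _) _; have := nX i j; have := nY i j; lra.
Qed.

Lemma exposing_exists A : sym_boundary (@CP R n) A -> sym_interior (@DNN R n) A ->
  exists (c : 'I_n -> 'I_n -> R) k (B : 'M[R]_(n, k)),
  [/\ exposing c, A = B *m B^T & forall p, zero_of c (B^~ p)].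
Proof.
move=> [/CP_closed [k [B [B0 eA]]] /CP_support[C [sC C1 cC CA]]] [sA [e [e0 hA]]].
have zB p : zero_of (coform C) (B^~ p).
  split=> [i|]; first exact: B0.
  have q0 q : true -> 0 <= qf (coform C) (B^~ q) by move=> _; apply: cC.
  have : \sum_q qf (coform C) (B^~ q) = 0.
    apply/le_anti; rewrite sumr_ge0 // andbT -sum_gram -eA; exact: CA.
  by move/(psumr_eq0P q0) => /(_ p isT).
have e2 : 0 < e / 2 by rewrite divr_gt0.
have e2e : e / 2 < e by rewrite ltr_pdivrMr //; lra.
exists (coform C), k, B; split=> //; split=> //.
- by move=> i j; rewrite /coform -{1}sC mxE.
- apply: contrapT => h; have : frob C C = 0.
    rewrite /frob big1 // => i _; rewrite big1 // => j _.
    suff -> : C i j = 0 by rewrite mul0r.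
    by apply: contrapT => /eqP cij; apply: h; exists i, j.
  by rewrite C1 => /eqP; rewrite oner_eq0.
- move=> i j.
  (* Entries of [A] are at least [e / 2], so some column of [B] is positive at both [i] and [j]. *)
  have [_ /(_ i j)] : DNN (A - const_mx (e / 2)).
    apply: hA; first by rewrite /Defs.is_sym linearB /= sA trmx_const.
    by move=> p q; rewrite !mxE opprB addrC subrK ger0_norm // ltW.
  rewrite !mxE subr_ge0 => /(lt_le_trans e2).
  rewrite eA gramE => h; have [p Bp] : exists p, 0 < B i p * B j p.
    apply: contrapT => np; move: h; rewrite big1 ?ltxx // => p _.
    apply/eqP; rewrite eq_le mulr_ge0 // andbT leNgt; apply/negP => ?.
    by apply: np; exists p.
  exists (B^~ p); split=> //; rewrite lt_def B0 andbT.
    by apply/eqP => h0; rewrite h0 mul0r ltxx in Bp.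
  by apply/eqP => h0; rewrite h0 mulr0 ltxx in Bp.
move=> x hx i; pose y : 'cV[R]_n := \col_i x i.
(* The form [x^T A x] dominates [e / 2] times the squared norm, yet it vanishes at a vector
   orthogonal to all columns of [B]. *)
have [[_ /(_ y) qy] _] : DNN (A - (e / 2)%:M).
  apply: hA; first by rewrite /Defs.is_sym linearB /= sA tr_scalar_mx.
  move=> p q; rewrite !mxE opprB addrC subrK; case: (p == q).
    by rewrite mulr1n ger0_norm // ltW.
  by rewrite mulr0n normr0.
have yB : y^T *m B = 0.
  apply/rowP => p; rewrite mxE [RHS]mxE -[RHS](hx _ (zB p)).
  by apply: eq_bigr => j _; rewrite !mxE.
move: qy; rewrite mulmxBr eA mulmxA yB mul0mx sub0r mul_mx_scalar mulNmx -scalemxAl mxE mxE.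
rewrite oppr_ge0 pmulr_rle0 // mxE => h.
have /psumr_eq0P h0 : \sum_j y^T 0 j * y j 0 = 0.
  apply/le_anti; rewrite h /= sumr_ge0 // => j _; rewrite mxE -expr2; exact: sqr_ge0.
have /eqP : y^T 0 i * y i 0 = 0.
  by apply: h0 => // j _; rewrite mxE -expr2; exact: sqr_ge0.
by rewrite !mxE mulf_eq0 orbb => /eqP.
Qed.

Lemma rational_mxP (A : 'M[R]_n) : (forall i j, rational (A i j)) -> rational_mx A.
Proof.
move=> h; have /choice[f hf] : forall ij : 'I_n * 'I_n, exists q : rat, A ij.1 ij.2 = ratr q.
  by move=> [i j]; have [q _ <-] := h i j; exists q.
by exists (\matrix_(i, j) f (i, j)); apply/matrixP => i j; rewrite !mxE (hf (i, j)).
Qed.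
End Boundary.

Theorem theorem2p12 (R : realType) (A : 'M[R]_5) :
  sym_boundary (@CP R 5) A -> sym_interior (@DNN R 5) A ->
  sym_closure
    (fun B : 'M[R]_5 =>
       [/\ sym_boundary (@CP R 5) B, sym_interior (@DNN R 5) B & rational_mx B])
    A.
Proof.
move=> bA iA; have [c [k [B [ec eA zB]]]] := exposing_exists bA iA.
split; first by case: iA.
move=> e e0; have [r r0 hr] := interior_near iA.
have [v [rv cv gv]] := exposing_approximable ec zB.
pose X n : 'M[R]_5 := (\matrix_(i, p) v n p i) *m (\matrix_(i, p) v n p i)^T.
have XE n i j : X n i j = \sum_p v n p i * v n p j.
  by rewrite gramE; apply: eq_bigr => p _; rewrite !mxE.
have cX i j : X n i j @[n --> \oo] --> A i j.
  rewrite eA gramE; under eq_fun do rewrite XE.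
  apply: cvg_big => [|p _]; first exact: add_continuous.
  exact: cvgM.
(* Radius [e] is for the closure, radius [r] for staying in the doubly nonnegative interior. *)
pose d := Num.min e r; have d0 : 0 < d by rewrite lt_min e0 r0.
have nA : \forall n \near \oo, near_mx A (X n) d.
  apply: filter_forall => i; apply: filter_forall => j.
  by have /cvgrPdist_lt/(_ d d0) := cX i j.
near \oo => n; have nX : near_mx A (X n) d by near: n.
have [c' [_ cc' ci' zc']] : exists c' : 'I_5 -> 'I_5 -> R,
    [/\ symf c', copos c', exists i, 0 < c' i i & forall p, zero_of c' (v n p)].
  by near: n.
have sX : Defs.is_sym (X n) by rewrite /Defs.is_sym /X trmx_mul trmxK.
exists (X n); split=> //; split.
  by move=> i j; apply: lt_le_trans (nX i j) _; rewrite ge_min lexx.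
split.
- apply: boundary_gram cc' ci' _ => p.
  by have := zc' p; congr zero_of; apply/funext => i; rewrite mxE.
- by apply: hr => // i j; apply: lt_le_trans (nX i j) _; rewrite ge_min lexx orbT.
- apply: rational_mxP => i j; rewrite XE; apply: rational_sum => p.
  exact: rationalM.
Unshelve. all: by end_near. Qed.
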